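(* Let $Y$ be an analytic $AIM$-subspace of a (complex) Banach lattice $X$. Let $S$ be a $d$-isomorphism of $X$, let $A \in Z(X)$, let $T = AS$, and assume $TY \subseteq Y$. Then the set $|\sigma(T,Y)| = \{|\lambda| : \lambda \in \sigma(T,Y)\}$ is a connected subset of $\mathbb{R}$.
   Context: All Banach lattices are over $\mathbb{C}$. $Z(X)$ is the center of $X$ (all linear operators $A$ on $X$ for which there is $c \geq 0$ with $|Ax| \leq c|x|$ for all $x \in X$). A $d$-isomorphism of $X$ is a linear, bounded, invertible operator $S$ on $X$ that preserves disjointness, i.e. $|x_1| \wedge |x_2| = 0$ implies $|Sx_1| \wedge |Sx_2| = 0$. $\sigma(T,Y)$ is the spectrum of the restriction of $T$ to the $T$-invariant Banach space $Y$. A closed subspace $Y$ of $X$ is an $AIM$-subspace (approximating in modulus) if for any $x \in X$ and any $\varepsilon > 0$ there is $y \in Y$ such that $\||x| - |y|\| \leq \varepsilon$. A closed subspace $Y$ of $X$ is analytic if for any nonzero band $E$ in $X$ the implication holds: $y \in Y$, $y \perp E$ $\Rightarrow$ $y = 0$ (here $y \perp E$ means $|y| \wedge |e| = 0$ for all $e \in E$). *)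

(* Defs.v *)
From HB Require Import structures.
From mathcomp Require Import all_boot all_order all_algebra.
From mathcomp Require Import complex.
From mathcomp Require Import all_classical all_reals all_analysis.

Set Implicit Arguments.
Unset Strict Implicit.
Unset Printing Implicit Defensive.

Import Order.TTheory GRing.Theory Num.Theory.
Import numFieldNormedType.Exports.

Local Open Scope classical_set_scope.
Local Open Scope complex_scope.
Local Open Scope ring_scope.

(* The order is a bare relation rather than a MathComp order structure because
   the joins of Order.Lattice with the Zmodule and NormedModule structures do
   not exist in the hierarchy below RealDomain and cannot be added afterwards. *)
HB.mixin Record isVectorLattice (R : realType) E of GRing.Lmodule R E := {
  lev : E -> E -> Prop ;
  joinv : E -> E -> E ;
  meetv : E -> E -> E ;
  lev_refl : forall x, lev x x ;
  lev_anti : forall x y, lev x y -> lev y x -> x = y ;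
  lev_trans : forall y x z, lev x y -> lev y z -> lev x z ;
  lev_joinP : forall x y z, lev (joinv x y) z <-> lev x z /\ lev y z ;
  lev_meetP : forall x y z, lev z (meetv x y) <-> lev z x /\ lev z y ;
  lev_add2r : forall z x y, lev x y -> lev (x + z) (y + z) ;
  lev_wpscale : forall (a : R) x y, 0 <= a -> lev x y -> lev (a *: x) (a *: y)
}.

#[short(type="vectorLatticeType")]
HB.structure Definition VectorLattice (R : realType) :=
  {E of GRing.Lmodule R E & isVectorLattice R E}.

Definition absv {R : realType} {E : vectorLatticeType R} (x : E) : E :=
  joinv x (- x).

Definition is_sup {R : realType} {E : vectorLatticeType R}
    (D : set E) (s : E) : Prop :=
  (forall d, D d -> lev d s) /\
  (forall b, (forall d, D d -> lev d b) -> lev s b).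

HB.mixin Record isRealBanachLattice (R : realType) E
    of VectorLattice R E & CompleteNormedModule R E := {
  lev_norm : forall x y : E, lev (absv x) (absv y) -> `|x| <= `|y|
}.

#[short(type="realBanachLatticeType")]
HB.structure Definition RealBanachLattice (R : realType) :=
  {E of VectorLattice R E & CompleteNormedModule R E
      & isRealBanachLattice R E}.

(* A complex Banach lattice is the complexification X = E + iE of a real Banach
   lattice E, with modulus |x + iy| = sup_t (cos t x + sin t y) in E and norm
   `|z| = `| |z| |. *)
HB.mixin Record isComplexification (R : realType) (E : realBanachLatticeType R)
    X of CompleteNormedModule R[i] X := {
  vreal : E -> X ;
  vRe : X -> E ;
  vIm : X -> E ;
  vmod : X -> E ;
  vrealD : forall x y, vreal (x + y) = vreal x + vreal y ;
  vrealZ : forall (a : R) x, vreal (a *: x) = a%:C *: vreal x ;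
  vReImE : forall z, z = vreal (vRe z) + (0 +i* 1) *: vreal (vIm z) ;
  vRe_rect : forall x y, vRe (vreal x + (0 +i* 1) *: vreal y) = x ;
  vIm_rect : forall x y, vIm (vreal x + (0 +i* 1) *: vreal y) = y ;
  vmod_sup : forall z,
    is_sup [set cos t *: vRe z + sin t *: vIm z | t in [set: R]] (vmod z) ;
  norm_vmod : forall z : X, `|z| = `|vmod z|%:C
}.

#[short(type="complexBanachLatticeType")]
HB.structure Definition ComplexBanachLattice (R : realType)
    (E : realBanachLatticeType R) :=
  {X of CompleteNormedModule R[i] X & isComplexification R E X}.

Section ComplexBanachLatticeDefs.
Context {R : realType} {E : realBanachLatticeType R}.
Context {X : complexBanachLatticeType E}.
Implicit Types (x y : X) (Y B : set X) (S T V A : X -> X).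

Definition disjointv x y : Prop := meetv (vmod x) (vmod y) = 0.

Definition closed_subspace Y : Prop := submod_closed [in Y] /\ closed Y.

(* The bands of X are the B + iB with B a band of E; this is an ideal of X
   that contains the suprema in E of its sets of real elements. *)
Definition is_band B : Prop :=
  [/\ submod_closed [in B],
      forall x y, B y -> lev (vmod x) (vmod y) -> B x
    & forall (D : set E) (s : E),
        (forall d, D d -> B (vreal d)) -> is_sup D s -> B (vreal s)].

Definition bounded_on Y T : Prop :=
  exists c : R, forall y, Y y -> `|T y| <= c%:C * `|y|.

Definition invertible_on Y T : Prop :=
  exists V, [/\ set_fun Y Y V, bounded_on Y V,
                {in Y, cancel T V} & {in Y, cancel V T}].

(* Meant for a bounded linear T mapping Y into Y. *)
Definition spectrum_on T Y : set R[i] :=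
  [set lam | ~ invertible_on Y (fun y => lam *: y - T y)].

Definition in_center A : Prop :=
  exists2 c : R, 0 <= c & forall x, lev (vmod (A x)) (c *: vmod x).

Definition d_isomorphism S : Prop :=
  [/\ bounded_on setT S, invertible_on setT S
    & forall x y, disjointv x y -> disjointv (S x) (S y)].

Definition AIM_subspace Y : Prop :=
  closed_subspace Y /\
  forall x (eps : R), 0 < eps ->
    exists2 y, Y y & `|vmod x - vmod y| <= eps.

Definition analytic_subspace Y : Prop :=
  closed_subspace Y /\
  forall B, is_band B -> B <> [set 0] ->
    forall y, Y y -> (forall e, B e -> disjointv y e) -> y = 0.

End ComplexBanachLatticeDefs.

(* Main.v *)
Require Import Defs.
From HB Require Import structures.
From mathcomp Require Import all_boot all_order all_algebra.
From mathcomp Require Import complex.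
From mathcomp Require Import all_classical all_reals all_analysis.
From mathcomp Require Import ring lra.

(** Suppose that no spectral value of [T] on [Y] has modulus [t], while some
    have smaller and some have larger modulus.  After division by [t] the unit
    circle misses the spectrum, which meets the open disc and its exterior; the
    contradiction comes from playing two facts against each other.

    The first fact is about [T] on the whole lattice.  [S] and [A], hence [T],
    are bounded and preserve disjointness, and such an operator [D] acts on
    moduli: [|D x| = | D |x| |] ([vmod_absop]), the map [absop D] sending
    [u >= 0] to [|D u|] being additive, monotone and compatible with meets.
    Continuity of [D] is essential here, and enters through [absopS].  For
    [tau = absop T] moreover every [u] below [tau^N v] is up to a small error
    [tau^N w] for some [w] between [0] and [v] ([iter_absop_interval]): [S] is
    onto, and a central operator can be inverted approximately by a Neumann
    series ([central_interval]).

    The second fact is spectral ([dichotomy]).  There are nonzero [y1], [y2] in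
    [Y] such that [T^j y1] tends to [0] exponentially and [y2] is for every [j]
    a limit of vectors [T^j z] with [z] exponentially small in [j]; and
    [|T^N y| <= B (|y| + |T^(2N) y|)] for all [y] in [Y] and [N = 2^k].
    Classically, [y1] and [y2] lie in the ranges of the two Riesz projections.
    Contour integrals are replaced by the average of [w (w - T)^-1] over the
    numbers [w] with [w^(2^k) = rho^(2^k)].  This average is the inverse of
    [1 - (T / rho)^(2^k)]; it is obtained by halving [k] times ([dyres]), so that
    bounds for the resolvent on the circle are inherited by every average, and
    it converges as [k] grows because the resolvent is Lipschitz on the circle.

    To conclude, the last estimate only involves moduli, so that it holds with
    [tau] for all positive elements of the lattice, because their distance to
    moduli of elements of [Y] is zero ([positive_estimate]).  Apply it to
    [u = |y1| /\ |y2|].  As [u] is almost below [tau^N |z|], it is almost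
    [tau^N w] with [w <= |z|] small, while [tau^(2N) w], which is almost
    [tau^N u <= tau^N |y1|], is small too; hence [u] is small
    ([meet_estimate]).  So [u = 0]: [y1] is disjoint from the nonzero band
    generated by [y2], which is impossible in an analytic subspace. *)

Set Implicit Arguments.
Unset Strict Implicit.
Unset Printing Implicit Defensive.

Import Order.TTheory GRing.Theory Num.Theory.
Import numFieldNormedType.Exports.

Local Open Scope classical_set_scope.
Local Open Scope complex_scope.
Local Open Scope ring_scope.

(** * Identities between linear combinations *)

Section ModuleExpressions.
Variables (R : comPzRingType) (E : lmodType R).

Inductive mexpr :=
| MVar of nat | MZero | MAdd of mexpr & mexpr | MOpp of mexpr | MScale of R & mexpr.

Fixpoint meval (env : seq E) e : E :=
  match e with
  | MVar i => nth 0 env i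
  | MZero => 0
  | MAdd a b => meval env a + meval env b
  | MOpp a => - meval env a
  | MScale c a => c *: meval env a
  end.

Fixpoint mcoef e (i : nat) : R :=
  match e with
  | MVar j => if eqn j i then 1 else 0
  | MZero => 0
  | MAdd a b => mcoef a i + mcoef b i
  | MOpp a => - mcoef a i
  | MScale c a => c * mcoef a i
  end.

Fixpoint mallvars (P : nat -> Prop) n : Prop :=
  if n is m.+1 then mallvars P m /\ P m else True.

Lemma mevalE env e : meval env e = \sum_(i < size env) mcoef e i *: env`_i.
Proof.
elim: e => [j||a IHa b IHb|a IHa|c a IHa] /=.
- have [jlt|jge] := ltnP j (size env).
    rewrite (bigD1 (Ordinal jlt)) //= eqnE eqxx scale1r big1 ?addr0 // => i.
    by rewrite -val_eqE /= eq_sym => /negPf ->; rewrite scale0r.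
  rewrite nth_default // big1 // => i _.
  by rewrite eqnE gtn_eqF ?scale0r // (leq_trans (ltn_ord i)).
- by rewrite big1 // => i _; rewrite scale0r.
- by rewrite IHa IHb -big_split; apply: eq_bigr => i _; rewrite scalerDl.
- by rewrite IHa -sumrN; apply: eq_bigr => i _; rewrite scaleNr.
- by rewrite IHa scaler_sumr; apply: eq_bigr => i _; rewrite scalerA.
Qed.

Lemma mexpr_eq env a b :
  mallvars (fun i => mcoef a i = mcoef b i) (size env) ->
  meval env a = meval env b.
Proof.
move=> h; rewrite !mevalE; apply: eq_bigr => i _; congr (_ *: _).
elim: (size env) h (val i) (ltn_ord i) => //= n IH [hn hi] j.
by rewrite ltnS leq_eqVlt => /predU1P[->//|]; exact: IH.
Qed.

End ModuleExpressions.

Ltac mlookup x l :=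
  match l with
  | ?y :: _ => let _ := match goal with _ => unify x y end in constr:(O)
  | _ :: ?t => let n := mlookup x t in constr:(S n)
  end.
Ltac minsert x l :=
  match l with
  | _ => let _ := mlookup x l in l
  | _ => constr:(x :: l)
  end.
Ltac mvars t l :=
  lazymatch t with
  | (?a + ?b)%R => let l1 := mvars a l in mvars b l1
  | (- ?a)%R => mvars a l
  | (?c *: ?a)%R => mvars a l
  | 0%R => l
  | _ => minsert t l
  end.
Ltac mreify R t l :=
  lazymatch t with
  | (?a + ?b)%R =>
      let a' := mreify R a l in let b' := mreify R b l in constr:(@MAdd R a' b')
  | (- ?a)%R => let a' := mreify R a l in constr:(@MOpp R a')
  | (?c *: ?a)%R => let a' := mreify R a l in constr:(@MScale R c a')
  | 0%R => constr:(@MZero R)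
  | _ => let i := mlookup t l in constr:(@MVar R i)
  end.
(** Both sides are reified over their common atoms, up to conversion; the
    identity is then proved coefficient by coefficient. *)
Ltac module_over R tac :=
  lazymatch goal with
  | |- @eq ?T ?a ?b =>
      let l0 := constr:(@nil T) in
      let l1 := mvars a l0 in let l := mvars b l1 in
      let a' := mreify R a l in let b' := mreify R b l in
      apply: (@mexpr_eq R _ l a' b'); cbn [mallvars size mcoef eqn];
      repeat split; tac
  end.

Ltac module :=
  lazymatch goal with
  | R : realType |- _ =>
      module_over (R : comPzRingType) ltac:(first [ring | lra | by field])
  end.

Ltac cmodule :=
  lazymatch goal with
  | R : realType |- _ => module_over (R[i] : comPzRingType) ltac:(first [ring | by field])
  end.

(** * Vector lattices *)

Section VectorLattice.
Variables (R : realType) (E : vectorLatticeType R).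
Implicit Types (x y z a b c d : E) (k : R).

Definition posv x : E := joinv x 0.

Lemma levT y x z : lev x y -> lev y z -> lev x z.
Proof. exact: lev_trans. Qed.
Arguments levT {y x z}.

(** Linear arithmetic in the ordered space: an inequality follows from others
    as soon as the differences of their sides add up to its own. *)
Lemma lev_eq1 a b x y : lev a b -> y - x = b - a -> lev x y.
Proof.
move=> /(lev_add2r (x - a)) h e.
have -> : x = a + (x - a) by module.
by have -> : y = b + (x - a) by apply: (addIr (- x)); rewrite e; module.
Qed.

Lemma lev_add a b c d : lev a b -> lev c d -> lev (a + c) (b + d).
Proof.
move=> h1 h2; apply: (levT (lev_add2r c _ _ h1)).
by apply: (lev_eq1 h2); module.
Qed.

Lemma lev_eq2 a b c d x y :
  lev a b -> lev c d -> y - x = (b - a) + (d - c) -> lev x y.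
Proof. by move=> h1 h2 e; apply: (lev_eq1 (lev_add h1 h2)); rewrite e; module. Qed.

Lemma lev_eq3 a b c d a' b' x y :
  lev a b -> lev c d -> lev a' b' ->
  y - x = (b - a) + (d - c) + (b' - a') -> lev x y.
Proof. by move=> h1 h2 h3 e; apply: (lev_eq2 (lev_add h1 h2) h3); rewrite e; module. Qed.

Lemma lev_addr x y : lev 0 y -> lev x (x + y).
Proof. by move=> h; apply: (lev_eq1 h); module. Qed.

Lemma lev_opp x y : lev x y -> lev (- y) (- x).
Proof. by move=> h; apply: (lev_eq1 h); module. Qed.

Lemma lev_scale k x y : 0 <= k -> lev x y -> lev (k *: x) (k *: y).
Proof. exact: lev_wpscale. Qed.

Lemma lev_scale0 k x : 0 <= k -> lev 0 x -> lev 0 (k *: x).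
Proof. by move=> k0 /(lev_scale k0); rewrite scaler0. Qed.

Lemma lev_add0 x y : lev 0 x -> lev 0 y -> lev 0 (x + y).
Proof. by move=> hx hy; have := lev_add hx hy; rewrite addr0. Qed.

Lemma lev_scale_l k x : k <= 1 -> lev 0 x -> lev (k *: x) x.
Proof.
move=> k1 x0; have h : 0 <= 1 - k by lra.
by apply: (lev_eq1 (lev_scale0 h x0)); module.
Qed.

Lemma lev_scale2 k l x : k <= l -> lev 0 x -> lev (k *: x) (l *: x).
Proof.
move=> k1 x0; have h : 0 <= l - k by lra.
by apply: (lev_eq1 (lev_scale0 h x0)); module.
Qed.

Lemma levUl x y : lev x (joinv x y).
Proof. by have /lev_joinP[] := lev_refl (joinv x y). Qed.
Lemma levUr x y : lev y (joinv x y).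
Proof. by have /lev_joinP[] := lev_refl (joinv x y). Qed.
Lemma levIl x y : lev (meetv x y) x.
Proof. by have /lev_meetP[] := lev_refl (meetv x y). Qed.
Lemma levIr x y : lev (meetv x y) y.
Proof. by have /lev_meetP[] := lev_refl (meetv x y). Qed.
Lemma levU x y z : lev x z -> lev y z -> lev (joinv x y) z.
Proof. by move=> *; apply/lev_joinP. Qed.
Lemma levI x y z : lev z x -> lev z y -> lev z (meetv x y).
Proof. by move=> *; apply/lev_meetP. Qed.

Lemma meetvC x y : meetv x y = meetv y x.
Proof. by apply: lev_anti; apply: levI; rewrite ?levIl ?levIr//; (exact: levIl || exact: levIr). Qed.

Lemma meetvDr x y z : meetv (x + z) (y + z) = meetv x y + z.
Proof.
apply: lev_anti.
  have h : lev (meetv (x + z) (y + z) - z) (meetv x y).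
    apply: levI; [apply: (lev_eq1 (levIl (x + z) (y + z)))|
                  apply: (lev_eq1 (levIr (x + z) (y + z)))]; module.
  by apply: (lev_eq1 h); module.
by apply: levI; apply: lev_add2r; [exact: levIl|exact: levIr].
Qed.

Lemma meetvN x y : meetv (- x) (- y) = - joinv x y.
Proof.
apply: lev_anti.
  have h : lev (joinv x y) (- meetv (- x) (- y)).
    apply: levU; [apply: (lev_eq1 (levIl (- x) (- y)))|
                  apply: (lev_eq1 (levIr (- x) (- y)))]; module.
  by apply: (lev_eq1 h); module.
by apply: levI; apply: lev_opp; [exact: levUl|exact: levUr].
Qed.

Lemma joinv_meetv x y : joinv x y + meetv x y = x + y.
Proof.
have -> : joinv x y = - meetv (- x) (- y) by rewrite meetvN opprK.
have -> : meetv (- x) (- y) = meetv x y - (x + y).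
  by rewrite -meetvDr meetvC; congr meetv; module.
by module.
Qed.

Lemma meetvS a b c d : lev a b -> lev c d -> lev (meetv a c) (meetv b d).
Proof.
by move=> h1 h2; apply: levI; [apply: lev_trans h1; exact: levIl|
  apply: lev_trans h2; exact: levIr].
Qed.

Lemma meetv_l x y : lev x y -> meetv x y = x.
Proof. by move=> h; apply: lev_anti; [exact: levIl|apply: levI => //; exact: lev_refl]. Qed.

Lemma meetv_ge0 x y : lev 0 x -> lev 0 y -> lev 0 (meetv x y).
Proof. exact: levI. Qed.

Lemma meetvZ k x y : 0 < k -> meetv (k *: x) (k *: y) = k *: meetv x y.
Proof.
move=> k0; apply: lev_anti; last first.
  by apply: levI; apply: lev_scale; rewrite ?ltW//; [exact: levIl|exact: levIr].
have k1 : 0 <= k^-1 by rewrite invr_ge0 ltW.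
have h : lev (k^-1 *: meetv (k *: x) (k *: y)) (meetv x y).
  apply: levI.
    by have := lev_scale k1 (levIl (k *: x) (k *: y)); rewrite scalerA mulVf ?gt_eqF// scale1r.
  by have := lev_scale k1 (levIr (k *: x) (k *: y)); rewrite scalerA mulVf ?gt_eqF// scale1r.
by have := lev_scale (ltW k0) h; rewrite scalerA divff ?gt_eqF// scale1r.
Qed.

(** [a /\ (b + c) - a /\ c] is below [a] because [a /\ c >= 0], and below [b]
    because [a <= b + a]. *)
Lemma meetv_addl a b c : lev 0 a -> lev 0 b -> lev 0 c ->
  lev (meetv a (b + c)) (meetv a b + meetv a c).
Proof.
move=> a0 b0 c0.
have h : lev (meetv a (b + c) - meetv a c) (meetv a b).
  have m0 := meetv_ge0 a0 c0.
  apply: levI; first by apply: (lev_eq2 (levIl a (b + c)) m0); module.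
  have : lev (meetv a (b + c)) (b + meetv a c).
    rewrite [b + meetv _ _]addrC -meetvDr (addrC b c); apply: meetvS; last exact: lev_refl.
    exact: lev_addr.
  by move=> h; apply: (lev_eq1 h); module.
by apply: (lev_eq1 h); module.
Qed.

Lemma disj_le a b c : meetv a b = 0 -> lev 0 b -> lev 0 c -> lev c a -> meetv c b = 0.
Proof.
move=> h b0 c0 ca; apply: lev_anti; last exact: meetv_ge0.
by rewrite -h; apply: meetvS => //; exact: lev_refl.
Qed.

Lemma disj_le2 a b c d : meetv a b = 0 -> lev 0 c -> lev c a -> lev 0 d -> lev d b ->
  meetv c d = 0.
Proof.
move=> h c0 ca d0 db; apply: lev_anti; last exact: meetv_ge0.
by rewrite -h; apply: meetvS.
Qed.

Lemma disjD a b c : meetv a b = 0 -> meetv a c = 0 ->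
  lev 0 a -> lev 0 b -> lev 0 c -> meetv a (b + c) = 0.
Proof.
move=> h1 h2 a0 b0 c0; apply: lev_anti; last by apply: meetv_ge0 => //; exact: lev_add0.
by apply: (levT (meetv_addl a0 b0 c0)); rewrite h1 h2 addr0; exact: lev_refl.
Qed.

Lemma disjZ k a b : meetv a b = 0 -> lev 0 a -> lev 0 b -> 0 <= k -> meetv a (k *: b) = 0.
Proof.
move=> h a0 b0 k0; have k1 : 0 < 1 + k by lra.
apply: (@disj_le2 ((1 + k) *: a) ((1 + k) *: b)) => //.
- by rewrite meetvZ// h scaler0.
- by rewrite -[X in lev X _]scale1r; apply: lev_scale2 => //; lra.
- exact: lev_scale0.
- by apply: lev_scale2 => //; lra.
Qed.

(** The sum of two elements is the sum of their join and their meet. *)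
Lemma disj_add_le a b c : meetv a b = 0 -> lev a c -> lev b c -> lev (a + b) c.
Proof. by move=> h ac bc; rewrite -joinv_meetv h addr0; exact: levU. Qed.

Lemma posv_ge0 x : lev 0 (posv x).
Proof. exact: levUr. Qed.
Lemma posv_ge x : lev x (posv x).
Proof. exact: levUl. Qed.
Lemma posvS x y : lev x y -> lev (posv x) (posv y).
Proof.
move=> h; apply: levU; last exact: posv_ge0.
by apply: (levT h); exact: posv_ge.
Qed.
Lemma posv_id x : lev 0 x -> posv x = x.
Proof.
move=> h; apply: lev_anti; last exact: posv_ge.
by apply: levU => //; exact: lev_refl.
Qed.
Lemma posv0 x : lev x 0 -> posv x = 0.
Proof.
move=> h; apply: lev_anti; last exact: posv_ge0.
by apply: levU => //; exact: lev_refl.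
Qed.

Lemma posv_sub x : posv x - posv (- x) = x.
Proof.
have := joinv_meetv x 0; rewrite -[meetv x 0]opprK -{2}[0]oppr0.
have -> : - meetv x (- 0) = posv (- x).
  by rewrite -[X in meetv X _](opprK x) meetvN opprK.
by rewrite addr0.
Qed.

Lemma posv_disj x : meetv (posv x) (posv (- x)) = 0.
Proof.
have := posv_sub x; set p := posv x; set n := posv (- x) => h.
have nE : n = p - x by rewrite -h; module.
have -> : meetv p n = meetv x 0 + n.
  by rewrite -meetvDr; congr meetv; rewrite ?add0r// -h; module.
have := joinv_meetv x 0; rewrite -/(posv x) -/p nE => e.
by rewrite addrA [meetv x 0 + p]addrC e; module.
Qed.

Lemma absv_ge x : lev x (absv x).
Proof. exact: levUl. Qed.
Lemma absv_geN x : lev (- x) (absv x).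
Proof. exact: levUr. Qed.
Lemma absvE x : absv x = posv x + posv (- x).
Proof.
have a0 : lev 0 (absv x).
  have h : lev 0 (2 *: absv x) by apply: (lev_eq2 (absv_ge x) (absv_geN x)); module.
  have -> : absv x = (1 / 2) *: (2 *: absv x) by module.
  by apply: lev_scale0 => //; lra.
apply: lev_anti.
  apply: levU; first by apply: (lev_eq2 (posv_ge x) (posv_ge0 (- x))); module.
  by apply: (lev_eq2 (posv_ge (- x)) (posv_ge0 x)); module.
by apply: disj_add_le; first exact: posv_disj; apply: levU => //; [exact: levUl|exact: levUr].
Qed.

Lemma absv_ge0 x : lev 0 (absv x).
Proof. by rewrite absvE; apply: lev_add0; exact: posv_ge0. Qed.
Lemma absv_id x : lev 0 x -> absv x = x.
Proof.
move=> h; rewrite absvE (posv_id h) posv0 ?addr0//.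
by apply: (lev_eq1 h); module.
Qed.
Lemma absv_le x y : lev x y -> lev (- x) y -> lev (absv x) y.
Proof. exact: levU. Qed.
Lemma absvN x : absv (- x) = absv x.
Proof. by rewrite !absvE opprK addrC. Qed.

Lemma meetv_lip a b c : lev (meetv a b) (meetv a c + absv (b - c)).
Proof.
rewrite -meetvDr; apply: meetvS; first by apply: (lev_eq1 (absv_ge0 (b - c))); module.
by apply: (lev_eq1 (absv_ge (b - c))); module.
Qed.
Lemma meetv_lip_abs a b c : lev (absv (meetv a b - meetv a c)) (absv (b - c)).
Proof.
apply: absv_le; first by apply: (lev_eq1 (meetv_lip a b c)); module.
have := meetv_lip a c b; rewrite -(absvN (c - b)) => h.
have e : - (c - b) = b - c by module.
by rewrite e in h; apply: (lev_eq1 h); module.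
Qed.

End VectorLattice.

(** * Closedness of the order *)

Section RealBanachLattice.
Variables (R : realType) (E : realBanachLatticeType R).
Implicit Types (x y z a b c d f g : E) (k : R).

Lemma norm_absv x : `|absv x| = `|x|.
Proof.
apply/eqP; rewrite eq_le; apply/andP; split; apply: lev_norm;
  by rewrite (absv_id (absv_ge0 x)); exact: lev_refl.
Qed.

Lemma lev_norm_ge0 x y : lev 0 x -> lev x y -> `|x| <= `|y|.
Proof.
move=> x0 xy; apply: lev_norm; rewrite absv_id// absv_id//.
exact: lev_trans xy.
Qed.

Lemma lev_absv_norm x y : lev (absv x) y -> `|x| <= `|y|.
Proof. by move=> h; rewrite -norm_absv; apply: lev_norm_ge0 => //; exact: absv_ge0. Qed.

(** Under the hypothesis the norm of the positive part of [x - y] is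
    arbitrarily small. *)
Lemma lev_closed x y : (forall e, 0 < e -> exists2 z, lev x (y + z) & `|z| <= e) -> lev x y.
Proof.
move=> h; suff p0 : posv (x - y) = 0.
  by have := posv_ge (x - y); rewrite p0 => h0; apply: (lev_eq1 h0); module.
apply/eqP; rewrite -normr_le0; apply/ler_addgt0Pl => e e0; rewrite addr0.
have [z hz ze] := h _ e0; apply: le_trans ze; rewrite -(norm_absv z).
apply: lev_norm_ge0; first exact: posv_ge0.
apply: levU; last exact: absv_ge0.
by apply: (lev_eq2 hz (absv_ge z)); module.
Qed.

Lemma lev_arch x y z : (forall e, 0 < e -> lev x (y + e *: z)) -> lev x y.
Proof.
move=> h; apply: lev_closed => e e0; exists ((e / (1 + `|z|)) *: z).
  by apply: h; rewrite divr_gt0// ltr_wpDr.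
rewrite normrZ ger0_norm; last by rewrite divr_ge0 ?ltW ?ltr_wpDr.
rewrite mulrAC ler_pdivrMr ?ltr_wpDr//; have := normr_ge0 z; nra.
Qed.

End RealBanachLattice.

(** * Complex numbers *)

Section ComplexAbs.
Variable R : realType.
Implicit Types (a b : R[i]) (t : R).

Definition cabs a : R := complex.Re `|a|.

Lemma cabsE a : `|a| = (cabs a)%:C.
Proof. by rewrite /cabs normc_def. Qed.

Lemma cabs_ge0 a : 0 <= cabs a.
Proof. by rewrite -lecR -cabsE normr_ge0. Qed.

Lemma sqr_cabs a : cabs a ^+ 2 = complex.Re a ^+ 2 + complex.Im a ^+ 2.
Proof. by rewrite /cabs normc_def /= sqr_sqrtr// addr_ge0// sqr_ge0. Qed.

Lemma cabsM a b : cabs (a * b) = cabs a * cabs b.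
Proof. by apply: complexI; rewrite rmorphM /= -!cabsE normrM. Qed.

Lemma cabsX a n : cabs (a ^+ n) = cabs a ^+ n.
Proof. by apply: complexI; rewrite rmorphXn /= -!cabsE normrX. Qed.

Lemma cabsV a : cabs a^-1 = (cabs a)^-1.
Proof. by apply: complexI; rewrite fmorphV /= -!cabsE normfV. Qed.

Lemma cabsD a b : cabs (a + b) <= cabs a + cabs b.
Proof. by rewrite -lecR rmorphD /= -!cabsE ler_normD. Qed.

Lemma cabsN a : cabs (- a) = cabs a.
Proof. by rewrite /cabs normrN. Qed.

Lemma cabsB a b : cabs (a - b) = cabs (b - a).
Proof. by rewrite -cabsN opprB. Qed.

Lemma cabs0 : cabs 0 = 0.
Proof. by rewrite /cabs normr0. Qed.

Lemma cabs1 : cabs 1 = 1.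
Proof. by rewrite /cabs normr1. Qed.

Lemma cabs_real k : 0 <= k -> cabs k%:C = k.
Proof. by move=> k0; rewrite /cabs ger0_norm ?ler0c. Qed.

Lemma cabs_eq0 a : (cabs a == 0) = (a == 0).
Proof. by rewrite -[RHS]normr_eq0 cabsE -(inj_eq (@complexI R)). Qed.

Lemma cabs_gt0 a : (0 < cabs a) = (a != 0).
Proof. by rewrite lt_neqAle cabs_ge0 andbT eq_sym cabs_eq0. Qed.

Definition cis t : R[i] := cos t +i* sin t.

Lemma cabs_cis t : cabs (cis t) = 1.
Proof.
apply/eqP; rewrite -(@eqrXn2 _ 2%N)// ?cabs_ge0//.
by rewrite sqr_cabs /= cos2Dsin2 expr1n.
Qed.

Lemma cisD s t : cis (s + t) = cis s * cis t.
Proof. by rewrite /cis cosD sinD; apply/eqP; rewrite eq_complex /=; apply/andP; split; apply/eqP; ring. Qed.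

Lemma cis_surj a : cabs a = 1 -> exists2 t, t \in `[- pi, pi] & a = cis t.
Proof.
case: a => x y /(congr1 (fun u => u ^+ 2)); rewrite sqr_cabs /= expr1n => e.
have x1 : -1 <= x <= 1 by have := sqr_ge0 y; nra.
have ac := acosK (_ : x \in `[(-1), 1]); rewrite in_itv /= in ac.
have sa := sin_acos x1.
have ee : 1 - x ^+ 2 = y ^+ 2 by rewrite -e; ring.
have a0 := acos_ge0 x1; have a1 := acos_lepi x1.
have p0 := pi_ge0 R.
rewrite ee sqrtr_sqr in sa.
have [y0|y0] := leP 0 y.
  exists (acos x); first by rewrite in_itv /=; apply/andP; split => //; lra.
  by rewrite /cis sa ac// ger0_norm.
exists (- acos x); first by rewrite in_itv /=; apply/andP; split => //; lra.
by rewrite /cis cosN sinN sa ac// ltr0_norm// opprK.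
Qed.

Lemma polar a : exists t, a = (cabs a)%:C * cis t.
Proof.
have [->|a0] := eqVneq a 0; first by exists 0; rewrite cabs0 mul0r.
have c0 : cabs a != 0 by rewrite cabs_eq0.
have [|t _ e] := @cis_surj (a / (cabs a)%:C).
  by rewrite cabsM cabsV cabs_real ?cabs_ge0// mulfV.
by exists t; rewrite -e mulrC mulfVK// (inj_eq (@complexI R)).
Qed.

End ComplexAbs.

(** * The modulus of a complex Banach lattice *)

Section RealNorm.
Variables (R : realType) (V : normedModType R[i]).
Implicit Types (x y : V).

(** Norms of a complex space are nonnegative complex numbers; estimates are
    made in [R]. *)
Definition rnorm x : R := complex.Re `|x|.

Lemma rnormE x : `|x| = (rnorm x)%:C.
Proof. by rewrite /rnorm -[in LHS]normr_id -[in RHS]normr_id normc_def. Qed.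

Lemma rnorm_ge0 x : 0 <= rnorm x.
Proof. by rewrite -lecR -rnormE normr_ge0. Qed.

Lemma rnormD x y : rnorm (x + y) <= rnorm x + rnorm y.
Proof. by rewrite -lecR rmorphD /= -!rnormE ler_normD. Qed.

Lemma rnormZ a x : rnorm (a *: x) = cabs a * rnorm x.
Proof. by apply: complexI; rewrite rmorphM /= -!rnormE normrZ cabsE. Qed.

Lemma rnormN x : rnorm (- x) = rnorm x.
Proof. by rewrite /rnorm normrN. Qed.

Lemma rnormB x y : rnorm (x - y) = rnorm (y - x).
Proof. by rewrite -rnormN opprB. Qed.

Lemma rnorm_eq0 x : (rnorm x == 0) = (x == 0).
Proof. by rewrite -[RHS]normr_eq0 rnormE -(inj_eq (@complexI R)). Qed.

Lemma rnorm0 : rnorm 0 = 0.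
Proof. by rewrite /rnorm normr0. Qed.

Lemma rnorm_triangle z x y : rnorm (x - y) <= rnorm (x - z) + rnorm (z - y).
Proof. by apply: (le_trans _ (rnormD _ _)); rewrite addrA subrK. Qed.

Lemma rnorm_small x : (forall e, 0 < e -> rnorm x <= e) -> x = 0.
Proof.
move=> h; apply/eqP; rewrite -rnorm_eq0 eq_le rnorm_ge0 andbT.
by apply/ler_addgt0Pl => e e0; rewrite addr0; exact: h.
Qed.

End RealNorm.

Section ComplexModulus.
Variables (R : realType) (E : realBanachLatticeType R) (X : complexBanachLatticeType E).
Implicit Types (x y z : X) (u v w : E) (a b : R[i]) (k s t : R).

Definition iC : R[i] := 0 +i* 1.

Lemma vreal0 : vreal 0 = 0 :> X.
Proof. by have := vrealZ (s := X) 0 0; rewrite !scale0r. Qed.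

Lemma vrealN u : vreal (- u) = - vreal u :> X.
Proof. by rewrite -scaleN1r vrealZ rmorphN1 scaleN1r. Qed.

Lemma vrealB u v : vreal (u - v) = vreal u - vreal v :> X.
Proof. by rewrite vrealD vrealN. Qed.

Lemma vrect z u v : z = vreal u + iC *: vreal v -> vRe z = u /\ vIm z = v.
Proof. by move=> ->; rewrite vRe_rect vIm_rect. Qed.

Lemma vRe_real u : vRe (vreal u : X) = u.
Proof. by have [] := @vrect (vreal u) u 0 _; rewrite // vreal0 scaler0 addr0. Qed.

Lemma vIm_real u : vIm (vreal u : X) = 0.
Proof. by have [] := @vrect (vreal u) u 0 _; rewrite // vreal0 scaler0 addr0. Qed.

Lemma vrectD x y : vRe (x + y) = vRe x + vRe y /\ vIm (x + y) = vIm x + vIm y.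
Proof.
apply: vrect; rewrite {1}[x]vReImE {1}[y]vReImE !vrealD scalerDr -/iC.
by rewrite addrACA.
Qed.
Lemma vReD x y : vRe (x + y) = vRe x + vRe y.
Proof. exact: (vrectD x y).1. Qed.
Lemma vImD x y : vIm (x + y) = vIm x + vIm y.
Proof. exact: (vrectD x y).2. Qed.

Lemma vrectZ a x :
  vRe (a *: x) = complex.Re a *: vRe x - complex.Im a *: vIm x /\
  vIm (a *: x) = complex.Re a *: vIm x + complex.Im a *: vRe x.
Proof.
apply: vrect; rewrite {1}[x]vReImE vrealB vrealD !vrealZ -/iC.
rewrite !scalerDr !scalerA -scaleNr.
have e : a = (complex.Re a)%:C + (complex.Im a)%:C * iC.
  by case: a => p q; apply/eqP; rewrite eq_complex /=; apply/andP; split; apply/eqP; ring.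
have ei : iC * iC = -1.
  by apply/eqP; rewrite eq_complex /=; apply/andP; split; apply/eqP; ring.
rewrite {1 2}e !scalerDl -!addrA; congr (_ + _).
have -> : ((complex.Re a)%:C + (complex.Im a)%:C * iC) * iC = iC * (complex.Re a)%:C - (complex.Im a)%:C.
  by rewrite mulrDl -mulrA ei mulrN1 mulrC.
by cmodule.
Qed.

Lemma vReZ a x : vRe (a *: x) = complex.Re a *: vRe x - complex.Im a *: vIm x.
Proof. exact: (vrectZ a x).1. Qed.
Lemma vImZ a x : vIm (a *: x) = complex.Re a *: vIm x + complex.Im a *: vRe x.
Proof. exact: (vrectZ a x).2. Qed.

(** The real part of [cis (- t) *: z]. *)
Definition vdir t z : E := cos t *: vRe z + sin t *: vIm z.

Lemma vdir_le t z : lev (vdir t z) (vmod z).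
Proof. by have [h _] := vmod_sup z; apply: h; exists t. Qed.

Lemma vmod_le z u : (forall t, lev (vdir t z) u) -> lev (vmod z) u.
Proof. by move=> h; have [_ H] := vmod_sup z; apply: H => _ [t _ <-]; exact: h. Qed.

Lemma vdirD t x y : vdir t (x + y) = vdir t x + vdir t y.
Proof. by rewrite /vdir vReD vImD; module. Qed.

Lemma vdir_cis t s z : vdir t (cis s *: z) = vdir (t - s) z.
Proof. by rewrite /vdir vReZ vImZ /= cosB sinB; module. Qed.

Lemma vdir_scale t k z : vdir t (k%:C *: z) = k *: vdir t z.
Proof. by rewrite /vdir vReZ vImZ /=; module. Qed.

Lemma vdir_real t u : vdir t (vreal u : X) = cos t *: u.
Proof. by rewrite /vdir vRe_real vIm_real; module. Qed.

Lemma vdir0 z : vdir 0 z = vRe z.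
Proof. by rewrite /vdir cos0 sin0; module. Qed.

Lemma vdirN t z : vdir (t + pi) z = - vdir t z.
Proof. by rewrite /vdir cosDpi sinDpi; module. Qed.

Lemma vdir_abs t z : lev (absv (vdir t z)) (vmod z).
Proof. by apply: absv_le; rewrite -?vdirN; exact: vdir_le. Qed.

Lemma vRe_abs z : lev (absv (vRe z)) (vmod z).
Proof. by rewrite -vdir0; exact: vdir_abs. Qed.

Lemma vIm_abs z : lev (absv (vIm z)) (vmod z).
Proof.
have := vdir_abs (pi / 2) z; rewrite /vdir cos_pihalf sin_pihalf scale0r add0r.
by rewrite scale1r.
Qed.

Lemma vmod_ge0 z : lev 0 (vmod z).
Proof. exact: levT (absv_ge0 _) (vRe_abs z). Qed.

Lemma vmodD x y : lev (vmod (x + y)) (vmod x + vmod y).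
Proof. by apply: vmod_le => t; rewrite vdirD; apply: lev_add; exact: vdir_le. Qed.

Lemma vmod_cis s z : vmod (cis s *: z) = vmod z.
Proof.
apply: lev_anti; apply: vmod_le => t; first by rewrite vdir_cis; exact: vdir_le.
by have := vdir_le (t + s) (cis s *: z); rewrite vdir_cis addrK.
Qed.

Lemma vmod_scale k z : 0 <= k -> vmod (k%:C *: z) = k *: vmod z.
Proof.
have le k' z' : 0 <= k' -> lev (vmod (k'%:C *: z')) (k' *: vmod z').
  by move=> k0; apply: vmod_le => t; rewrite vdir_scale; apply: lev_scale => //; exact: vdir_le.
rewrite le_eqVlt => /predU1P[<-|k0].
  have /= := le 0 z (lexx 0); rewrite !scale0r => h.
  by apply: lev_anti => //; exact: vmod_ge0.
apply: lev_anti; first by apply: le; exact: ltW.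
have ki : 0 <= k^-1 by rewrite invr_ge0 ltW.
have := lev_scale (ltW k0) (le k^-1 (k%:C *: z) ki).
rewrite !scalerA mulfV ?gt_eqF// scale1r -rmorphM mulVf ?gt_eqF//.
by rewrite rmorph1 scale1r.
Qed.

Lemma vmodZ a z : vmod (a *: z) = cabs a *: vmod z.
Proof.
have [t e] := polar a; rewrite {1}e mulrC -scalerA vmod_cis vmod_scale//.
exact: cabs_ge0.
Qed.

Lemma vmodN z : vmod (- z) = vmod z.
Proof. by rewrite -scaleN1r vmodZ cabsN cabs1 scale1r. Qed.

Lemma vmodB x y : vmod (x - y) = vmod (y - x).
Proof. by rewrite -vmodN opprB. Qed.

Lemma vmod0 : vmod (0 : X) = 0.
Proof. by rewrite -(scale0r (0 : X)) vmodZ cabs0 scale0r. Qed.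

Lemma vmod_real u : vmod (vreal u : X) = absv u.
Proof.
apply: lev_anti.
  apply: vmod_le => t; rewrite vdir_real.
  have := sqr_ge0 (sin t); have := cos2Dsin2 t => h h1.
  have h2 : -1 <= cos t <= 1 by nra.
  have h3 : 0 <= 1 + cos t by lra.
  have h4 : 0 <= 1 - cos t by lra.
  rewrite absvE -{1}[u]posv_sub.
  apply: (lev_eq2 (lev_scale0 h4 (posv_ge0 u)) (lev_scale0 h3 (posv_ge0 (- u)))).
  by module.
by rewrite -{1}(vRe_real u); exact: vRe_abs.
Qed.

Lemma vmod_pos u : lev 0 u -> vmod (vreal u : X) = u.
Proof. by move=> u0; rewrite vmod_real absv_id. Qed.

Lemma vmod_dist x y : lev (absv (vmod x - vmod y)) (vmod (x - y)).
Proof.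
apply: absv_le.
  have := vmodD (x - y) y; rewrite subrK => h.
  by apply: (lev_eq1 h); module.
have := vmodD (y - x) x; rewrite subrK (vmodB y x) => h.
by apply: (lev_eq1 h); module.
Qed.

Lemma rnorm_vmod z : rnorm z = `|vmod z|.
Proof. by rewrite /rnorm norm_vmod. Qed.

Lemma rnorm_dist x y : `|vmod x - vmod y| <= rnorm (x - y).
Proof. by rewrite rnorm_vmod; exact: lev_absv_norm (vmod_dist x y). Qed.

End ComplexModulus.

(** * Operators that preserve disjointness *)

Section DisjointnessPreserving.
Variables (R : realType) (E : realBanachLatticeType R) (X : complexBanachLatticeType E).
Implicit Types (x y z : X) (u v w e f g : E) (k s t : R) (i j m n : nat).

(** [|x| <= |x + y| + |y|], and meeting with [|x|] discards [|y|].  So [|x|],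
    and likewise [|y|], is below [|x + y|]; being disjoint, so is their sum. *)
Lemma disj_vmodD x y : disjointv x y -> vmod (x + y) = vmod x + vmod y.
Proof.
move=> h; apply: lev_anti; first exact: vmodD.
have aux (x' y' : X) : disjointv x' y' -> lev (vmod x') (vmod (x' + y')).
  move=> h'.
  have x0 := vmod_ge0 x'; have y0 := vmod_ge0 y'; have s0 := vmod_ge0 (x' + y').
  have hs : lev (vmod x') (vmod (x' + y') + vmod y').
    have := vmodD (x' + y') (- y'); rewrite addrK vmodN; exact.
  rewrite -{1}(meetv_l hs); apply: (levT (meetv_addl x0 s0 y0)).
  by rewrite h' addr0; exact: levIr.
apply: disj_add_le => //; first exact: aux.
by rewrite addrC; apply: aux; rewrite /disjointv meetvC.
Qed.

Section OnRealPart.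
Variables (d : E -> X) (c : R).
Hypothesis dD : forall u v, d (u + v) = d u + d v.
Hypothesis dZ : forall k u, d (k *: u) = k%:C *: d u.
Hypothesis db : forall u, rnorm (d u) <= c * `|u|.
Hypothesis dd : forall u v, lev 0 u -> lev 0 v -> meetv u v = 0 ->
  disjointv (d u) (d v).

Local Notation G u := (vmod (d u)).

Lemma opN u : d (- u) = - d u.
Proof. by rewrite -scaleN1r dZ rmorphN1 scaleN1r. Qed.

Lemma op0 : d 0 = 0.
Proof. by have := dZ 0 0; rewrite !scale0r. Qed.

Lemma absopD u v : lev (G (u + v)) (G u + G v).
Proof. by rewrite dD; exact: vmodD. Qed.

Lemma absopN u : G (- u) = G u.
Proof. by rewrite opN vmodN. Qed.

Lemma absopZ k u : 0 <= k -> G (k *: u) = k *: G u.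
Proof. by move=> k0; rewrite dZ vmod_scale. Qed.

Section Tents.
Variables (n : nat) (u v : E).
Hypotheses (n0 : (0 < n)%N) (u0 : lev 0 u) (uv : lev u v).

Let w := n%:R^-1 *: v.
Let k i := posv (i%:R *: w - (u + w)).
Let k' i := posv ((u + w) - i%:R *: w).
(** Think of [u] as [s v] for a function [s] with values in the unit interval.
    With [a_i = (i - 1) / n], [k i] and [k' i] are the positive and negative
    parts of [a_i v - u], so that [k 1 = 0] and [k' (n + 1) = 0], and the second
    difference [tent i] of [k] is a bump of height [v / n] carried by the place
    where [s] is between [a_i] and [a_(i+2)].  Tents two steps apart are
    disjoint. *)
Definition tent i := k i.+2 - 2 *: k i.+1 + k i.

Let v0 : lev 0 v. Proof. exact: levT u0 uv. Qed.
Let w0 : lev 0 w. Proof. by apply: lev_scale0; rewrite ?invr_ge0. Qed.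
Let nw : n%:R *: w = v.
Proof. by rewrite scalerA mulfV ?scale1r// pnatr_eq0 -lt0n. Qed.

Let k_mono i j : (i <= j)%N -> lev (k i) (k j).
Proof.
move=> ij; apply: posvS.
have h : 0 <= j%:R - i%:R :> R by rewrite subr_ge0 ler_nat.
by apply: (lev_eq1 (lev_scale0 h w0)); module.
Qed.

Let k'_mono i j : (i <= j)%N -> lev (k' j) (k' i).
Proof.
move=> ij; apply: posvS.
have h : 0 <= j%:R - i%:R :> R by rewrite subr_ge0 ler_nat.
by apply: (lev_eq1 (lev_scale0 h w0)); module.
Qed.

Let k0 i : lev 0 (k i). Proof. exact: posv_ge0. Qed.
Let k'0 i : lev 0 (k' i). Proof. exact: posv_ge0. Qed.

Let k_sub i : k i - k' i = i%:R *: w - (u + w).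
Proof.
rewrite -[RHS]posv_sub; congr (_ - _); rewrite /k'; congr posv; module.
Qed.

Let k_disj i j : (i <= j)%N -> meetv (k i) (k' j) = 0.
Proof.
move=> ij; apply: (@disj_le _ _ (k j)) => //; last exact: k_mono.
have -> : k' j = posv (- (j%:R *: w - (u + w))) by congr posv; module.
exact: posv_disj.
Qed.

Let k_first : k 1 = 0.
Proof. by apply: posv0; apply: (lev_eq1 u0); module. Qed.

Let k'_last : k' n.+1 = 0.
Proof.
apply: posv0; have -> : u + w - n.+1%:R *: w = u - v.
  by rewrite -addn1 natrD -nw; module.
by apply: (lev_eq1 uv); module.
Qed.

Lemma tent_ge0 i : lev 0 (tent i).
Proof.
have h : lev (2 *: k i.+1) (k i.+2 + k i).
  rewrite -{1}(@posv_id _ _ (k i.+2 + k i)); last exact: lev_add0.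
  have -> : 2 *: k i.+1 = posv (2 *: (i.+1%:R *: w - (u + w))).
    apply: lev_anti.
      have h2 : lev (k i.+1) (2^-1 *: posv (2 *: (i.+1%:R *: w - (u + w)))).
        apply: levU; last by apply: lev_scale0; [rewrite invr_ge0|exact: posv_ge0].
        have h3 : 0 <= 2^-1 :> R by rewrite invr_ge0.
        by apply: (lev_eq1 (lev_scale h3 (posv_ge (2 *: (i.+1%:R *: w - (u + w)))))); module.
      have h3 : 0 <= 2 :> R by [].
      by apply: (lev_eq1 (lev_scale h3 h2)); module.
    apply: levU; first by apply: lev_scale => //; exact: posv_ge.
    by apply: lev_scale0 => //; exact: posv_ge0.
  apply: posvS.
  apply: (lev_eq2 (posv_ge (i.+2%:R *: w - (u + w))) (posv_ge (i%:R *: w - (u + w)))).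
  by rewrite -/(k _) -/(k _) -(addn2 i) -(addn1 i) !natrD; module.
by apply: (lev_eq1 h); rewrite /tent; module.
Qed.

Let tent_le i : lev (tent i) (k i.+2).
Proof.
apply: (lev_eq2 (k_mono (leqnSn i)) (k0 i.+1)); rewrite /tent; module.
Qed.

Let tent_le' i : lev (tent i) (k' i).
Proof.
have e : tent i = k' i.+2 - 2 *: k' i.+1 + k' i.
  have kE j : k j = k' j + (j%:R *: w - (u + w)) by rewrite -k_sub; module.
  by rewrite /tent !kE -(addn2 i) -(addn1 i) !natrD; module.
by apply: (lev_eq2 (k'_mono (leqnSn i.+1)) (k'0 i.+1)); rewrite e; module.
Qed.

Lemma tent_disj i j : (i.+2 <= j)%N -> meetv (tent i) (tent j) = 0.
Proof.
move=> ij; apply: (disj_le2 (k_disj ij)); (exact: tent_ge0 || exact: tent_le || exact: tent_le').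
Qed.

Fixpoint tent_sum (p : bool) m : E :=
  if m is i.+1 then tent_sum p i + (if odd i == p then tent i else 0) else 0.
Fixpoint abs_tent_sum (p : bool) m : E :=
  if m is i.+1 then abs_tent_sum p i + (if odd i == p then G (tent i) else 0) else 0.

Let tent_sum_ge0 p m : lev 0 (tent_sum p m).
Proof.
elim: m => [|i IH] /=; first exact: lev_refl.
by apply: lev_add0 => //; case: ifP => _; [exact: tent_ge0|exact: lev_refl].
Qed.

Let tent_sum_le p m : lev (tent_sum p m) (k m.+1 - k m).
Proof.
elim: m => [|i IH] /=.
  rewrite k_first; have -> : k 0 = 0; last by rewrite subrr; exact: lev_refl.
  by apply: lev_anti => //; rewrite -k_first; exact: k_mono.
have h : lev (if odd i == p then tent i else 0) (tent i).
  by case: ifP => _; [exact: lev_refl|exact: tent_ge0].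
by apply: (lev_eq2 IH h); rewrite /tent; module.
Qed.

Let tent_sum_disj p m i : (m <= i)%N -> odd i = p -> 
  meetv (tent i) (tent_sum p m) = 0.
Proof.
elim: m => [|j IH] /= mi op; first by rewrite meetvC meetv_l//; exact: tent_ge0.
have t0 := tent_ge0 i.
apply: disjD => //.
- exact: IH (ltnW mi) op.
- case: eqP => [oj|_]; last by rewrite meetvC meetv_l.
  rewrite meetvC; apply: tent_disj; rewrite ltn_neqAle mi andbT.
  by apply/eqP => ji; move: op; rewrite -ji /= oj; case: (p).
- by case: ifP => _; [exact: tent_ge0|exact: lev_refl].
Qed.

(** Tents with indices of the same parity are pairwise disjoint, hence so are
    their images; this is what bounds a sum of [n] moduli by the norm of a
    single image. *)
Lemma abs_tent_sumE p m : G (tent_sum p m) = abs_tent_sum p m.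
Proof.
elim: m => [|i IH] /=; first by rewrite op0 vmod0.
case: eqP => [oi|_]; last by rewrite !addr0.
rewrite -IH dD disj_vmodD//; apply: dd => //; first exact: tent_ge0.
by rewrite meetvC; exact: tent_sum_disj.
Qed.

Lemma norm_abs_tent_sum p m : `|abs_tent_sum p m| <= c * `|w|.
Proof.
rewrite -abs_tent_sumE.
(* A bound [c < 0] is possible if the lattice is trivial. *)
have c0 : 0 <= c \/ w = 0.
  have [->|wn] := eqVneq w 0; [by right|left].
  have := le_trans (rnorm_ge0 _) (db w).
  by rewrite pmulr_lge0// normr_gt0.
have tw : `|tent_sum p m| <= `|w|.
  apply: lev_norm_ge0 => //; apply: (levT (tent_sum_le p m)).
  have : lev (k m.+1) (k m + w).
    apply: levU; last exact: lev_add0.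
    apply: (lev_eq1 (posv_ge (m%:R *: w - (u + w)))).
    by rewrite -/(k _) -(addn1 m) natrD; module.
  by move=> h; apply: (lev_eq1 h); module.
rewrite -rnorm_vmod; apply: (le_trans (db _)); case: c0 => [c0|w00]; first exact: ler_wpM2l.
by move: tw; rewrite w00 normr0 normr_le0 => /eqP ->; rewrite normr0.
Qed.

Let f := posv (G u - G v).

Let f_split i : (0 < i)%N -> (i <= n.+1)%N -> 
  lev f (meetv f (G (k i)) + meetv f (G (k' i))).
Proof.
case: i => // i _ iN.
have f0 : lev 0 f by exact: posv_ge0.
have h : lev f (G (k i.+1) + G (k' i.+1)).
  apply: levU; last by apply: lev_add0; exact: vmod_ge0.
  pose a : R := i%:R / n%:R.
  have npos : 0 < n%:R :> R by rewrite ltr0n.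
  have a0 : 0 <= a by rewrite divr_ge0.
  have a1 : a <= 1 by rewrite ler_pdivrMr// mul1r ler_nat -ltnS.
  have ue : u = a *: v - (k i.+1 - k' i.+1).
    rewrite k_sub -(addn1 i) natrD /a /w; module.
  have h1 : lev (G u) (a *: G v + (G (k i.+1) + G (k' i.+1))).
    rewrite {1}ue -(absopZ _ a0); apply: (levT (absopD _ _)).
    apply: lev_add; first exact: lev_refl.
    by rewrite absopN; apply: (levT (absopD _ _)); rewrite absopN; exact: lev_refl.
  by apply: (lev_eq2 h1 (lev_scale_l a1 (vmod_ge0 (d v)))); module.
rewrite -{1}(meetv_l h); apply: meetv_addl => //; exact: vmod_ge0.
Qed.

Let step j : (j < n)%N ->
  lev (meetv f (G (k j.+2))) (meetv f (G (k j.+1)) + G (tent j)).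
Proof.
move=> jn.
have f0 : lev 0 f by exact: posv_ge0.
have g0 i : lev 0 (G (k i)) by exact: vmod_ge0.
have g'0 i : lev 0 (G (k' i)) by exact: vmod_ge0.
have gt0 : lev 0 (G (tent j)) by exact: vmod_ge0.
set al := meetv f (G (k j.+2)).
have al0 : lev 0 al by exact: meetv_ge0.
have h : lev al (meetv f (G (k j.+1)) + meetv f (G (k' j.+1))).
  by apply: (levT (levIl _ _)); apply: f_split => //; rewrite ltnS ltnW.
rewrite -{1}(meetv_l h).
apply: (levT (meetv_addl al0 (meetv_ge0 f0 (g0 _)) (meetv_ge0 f0 (g'0 _)))).
apply: lev_add; first exact: levIr.
have hh : lev (meetv al (meetv f (G (k' j.+1)))) (meetv (G (k' j.+1)) (G (k j.+2))).
  by rewrite meetvC; apply: meetvS; exact: levIr.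
apply: (levT hh).
have kt : lev (G (k j.+2)) (G (tent j) + (2 *: G (k j.+1) + G (k j))).
  have -> : k j.+2 = tent j + (2 *: k j.+1 + (- k j)) by rewrite /tent; module.
  apply: (levT (absopD _ _)); apply: lev_add; first exact: lev_refl.
  apply: (levT (absopD _ _)); rewrite absopN absopZ//; exact: lev_refl.
apply: (levT (meetvS (lev_refl _) kt)).
have s0 : lev 0 (2 *: G (k j.+1)) by exact: lev_scale0.
apply: (levT (meetv_addl (g'0 _) gt0 (lev_add0 s0 (g0 _)))).
have dj i : (i <= j.+1)%N -> meetv (G (k' j.+1)) (G (k i)) = 0.
  by move=> ij; rewrite meetvC; apply: dd => //; exact: k_disj.
rewrite [X in _ + X]disjD ?addr0//.
- exact: levIr.
- by apply: disjZ => //; exact: dj.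
- exact: dj.
Qed.

(** Let [f] be the positive part of [|d u| - |d v|].  Since [f] is below
    [|d u - a_i d v|], it is covered by its meets with [|d (k i)|] and
    [|d (k' i)|].  The first meet grows with [i] from [0] to [f], and what it
    gains from [i] to [i + 1] sits where [d (k i)] and [d (k (i - 1))] vanish,
    so that it is due to a tent. *)
Lemma absop_tents : lev (G u) (G v + (abs_tent_sum false n + abs_tent_sum true n)).
Proof.
have ind m : (m <= n)%N ->
    lev (meetv f (G (k m.+1))) (abs_tent_sum false m + abs_tent_sum true m).
  elim: m => [|j IH] jn /=.
    by rewrite k_first op0 vmod0 addr0; exact: levIr.
  apply: (lev_eq2 (step jn) (IH (ltnW jn))).
  by case: (odd j) => /=; module.
have := f_split (ltn0Sn n) (leqnn _); rewrite k'_last op0 vmod0 => h.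
have := levT h (lev_add (ind n (leqnn n)) (levIr f 0)); rewrite addr0 => hh.
by apply: (lev_eq2 hh (posv_ge (G u - G v))); rewrite -/f; module.
Qed.

End Tents.

(** The contribution of the tents is of order [1 / n]. *)
Lemma absopS u v : lev 0 u -> lev u v -> lev (G u) (G v).
Proof.
move=> u0 uv; apply: lev_closed => e e0.
pose n := (Num.truncn (2 * `|c| * `|v| / e)).+1.
have n0 : (0 < n)%N by [].
exists (abs_tent_sum n u v false n + abs_tent_sum n u v true n).
  exact: absop_tents.
apply: (le_trans (ler_normD _ _)).
have h p := norm_abs_tent_sum n u0 uv p n.
apply: (le_trans (lerD (h false) (h true))).
rewrite normrZ ger0_norm ?invr_ge0//.
have npos : 0 < n%:R :> R by rewrite ltr0n.
have hn : 2 * `|c| * `|v| / e < n%:R by exact: truncnS_gt.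
rewrite ltr_pdivrMr// in hn.
have vp := normr_ge0 v; have cp := ler_norm c.
rewrite mulrCA -mulrDr ler_pdivrMl//.
nra.
Qed.

(** Removing [m = u /\ v] leaves disjoint elements, with disjoint images. *)
Lemma absop_meet u v : lev 0 u -> lev 0 v -> lev (meetv (G u) (G v)) (G (meetv u v)).
Proof.
move=> u0 v0; set m := meetv u v.
have um : lev 0 (u - m) by apply: (lev_eq1 (levIl u v)); rewrite -/m; module.
have vm : lev 0 (v - m) by apply: (lev_eq1 (levIr u v)); rewrite -/m; module.
have dj : meetv (u - m) (v - m) = 0 by rewrite meetvDr subrr.
have hu : lev (G u) (G (u - m) + G m) by have := absopD (u - m) m; rewrite subrK.
have hv : lev (G v) (G (v - m) + G m) by have := absopD (v - m) m; rewrite subrK.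
apply: (levT (meetvS hu hv)); rewrite meetvDr.
have -> : meetv (G (u - m)) (G (v - m)) = 0 by exact: dd.
by rewrite add0r; exact: lev_refl.
Qed.

Lemma absop_abs u : lev (G u) (2 *: G (absv u)).
Proof.
have h1 : lev (G (posv u)) (G (absv u)).
  apply: absopS; first exact: posv_ge0.
  by rewrite absvE; apply: lev_addr; exact: posv_ge0.
have h2 : lev (G (posv (- u))) (G (absv u)).
  apply: absopS; first exact: posv_ge0.
  by rewrite absvE addrC; apply: lev_addr; exact: posv_ge0.
have h3 : lev (G u) (G (posv u) + G (posv (- u))).
  by rewrite -{1}(posv_sub u); apply: (levT (absopD _ _)); rewrite absopN; exact: lev_refl.
by apply: (lev_eq3 h1 h2 h3); module.
Qed.

End OnRealPart.

End DisjointnessPreserving.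

Section SmallAngle.
Variable R : realType.
Implicit Types (e t : R).

(** [p = 2 arctan e], from the rational parametrization of the circle. *)
Lemma small_angle e : 0 < e -> e <= 1 -> exists p : R,
  [/\ 0 < p <= pi, 0 < sin p, 0 <= cos p, 1 - cos p = e * sin p & sin p <= 2 * e].
Proof.
move=> e0 e1.
have d0 : 0 < 1 + e ^+ 2 by rewrite ltr_wpDr ?sqr_ge0.
pose c := (1 - e ^+ 2) / (1 + e ^+ 2); pose s := 2 * e / (1 + e ^+ 2).
have cs : cabs (c +i* s) = 1.
  apply/eqP; rewrite -(@eqrXn2 _ 2%N)// ?cabs_ge0// sqr_cabs /= /c /s; apply/eqP.
  by field; rewrite gt_eqF.
have s0 : 0 < s by rewrite divr_gt0// mulr_gt0.
have [p] := cis_surj cs; rewrite in_itv /= => /andP[pl pr] [pc ps].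
have p0 : 0 < p.
  rewrite ltNge; apply/negP => p0.
  have := @sin_ge0_pi R (- p); rewrite sinN -ps !oppr_ge0 [s <= 0]leNgt s0 p0 lerNl pl => h.
  by have := h isT.
exists p; rewrite -pc -ps; split => //.
- by rewrite p0.
- rewrite /c divr_ge0 ?(ltW d0)//; nra.
- by rewrite /c /s; field; rewrite gt_eqF.
- by rewrite ler_pdivrMr// ler_peMr// ?mulr_ge0 ?ltW// ltrDl exprn_gt0.
Qed.

Lemma cis_net e : 0 < e -> e <= 1 -> exists (n : nat) (th : nat -> R), forall t,
  exists i dl : R, [/\ (exists2 j : nat, (j < n)%N & i = th j), cis t = cis (i + dl),
    0 <= sin dl, 1 - cos dl <= e & sin dl <= 2 * e].
Proof.
move=> e0 e1; have [p [/andP[p0 ppi] sp0 cp0 cpe sp2]] := small_angle e0 e1.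
exists (Num.truncn (2 * pi / p)).+1, (fun j => j%:R * p - pi) => t.
have [t' + ->] := cis_surj (cabs_cis t); rewrite in_itv /= => /andP[tl tr].
have q0 : 0 <= (t' + pi) / p by rewrite divr_ge0 ?(ltW p0)//; lra.
set j := Num.truncn ((t' + pi) / p).
have /andP[jl jr] := truncn_itv q0; rewrite -/j in jl jr.
rewrite ler_pdivlMr// in jl; rewrite ltr_pdivrMr// -(addn1 j) natrD in jr.
exists (j%:R * p - pi), (t' - (j%:R * p - pi)).
set dl := t' - _.
have dl0 : 0 <= dl by rewrite /dl; lra.
have dlp : dl <= p by rewrite /dl; lra.
have cdl : cos p <= cos dl.
  by rewrite leNgt ltr_cos -?leNgt// in_itv /= ?(ltW p0) ?ppi ?dl0 ?(le_trans dlp).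
have sdl : 0 <= sin dl by apply: sin_ge0_pi; rewrite dl0 (le_trans dlp).
have h1 := cos2Dsin2 dl; have h2 := cos2Dsin2 p.
have cd1 : cos dl <= 1 by have := sqr_ge0 (sin dl); nra.
have sdp : sin dl <= sin p by nra.
have sp1 : sin p <= 1 by have := sqr_ge0 (cos p); nra.
split.
- exists j => //; rewrite ltnS /j; apply: le_truncn.
  by rewrite ler_pM2r ?invr_gt0//; lra.
- by congr cis; rewrite /dl; ring.
- exact: sdl.
- by nra.
- exact: le_trans sdp _.
Qed.

End SmallAngle.

Section Operator.
Variables (R : realType) (E : realBanachLatticeType R) (X : complexBanachLatticeType E).
Variables (D : {linear X -> X}) (c : R).
Hypothesis Db : forall x, rnorm (D x) <= c * rnorm x.
Hypothesis Dd : forall x y, disjointv x y -> disjointv (D x) (D y).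
Implicit Types (x y z : X) (u v w f g : E) (k s t e K : R) (i j m n : nat).

Definition absop (F : X -> X) u : E := vmod (F (vreal u)).
Local Notation d := (fun u => D (vreal u)).
Local Notation G := (absop D).

Let dD u v : d (u + v) = d u + d v. Proof. by rewrite /= vrealD linearD. Qed.
Let dZ k u : d (k *: u) = k%:C *: d u. Proof. by rewrite /= vrealZ linearZ. Qed.
Let db u : rnorm (d u) <= c * `|u|.
Proof. by apply: (le_trans (Db _)); rewrite rnorm_vmod vmod_real norm_absv. Qed.
Let dd u v : lev 0 u -> lev 0 v -> meetv u v = 0 -> disjointv (d u) (d v).
Proof. by move=> u0 v0 uv; apply: Dd; rewrite /disjointv !vmod_pos. Qed.

Lemma absop_ge0 u : lev 0 (G u). Proof. exact: vmod_ge0. Qed.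
Let GS u v : lev 0 u -> lev u v -> lev (G u) (G v).
Proof. exact: (absopS dD dZ db dd). Qed.
Let GD u v : lev (G (u + v)) (G u + G v). Proof. exact: (absopD dD). Qed.
Let GZ k u : 0 <= k -> G (k *: u) = k *: G u. Proof. exact: (absopZ dZ). Qed.
Let GN u : G (- u) = G u. Proof. exact: (absopN dZ). Qed.
Let GI u v : lev 0 u -> lev 0 v -> lev (meetv (G u) (G v)) (G (meetv u v)).
Proof. exact: (absop_meet dD dd). Qed.

Let Dre x : D x = d (vRe x) + iC R *: d (vIm x).
Proof. by rewrite {1}[x]vReImE linearD linearZ. Qed.

Let cabs_iC : cabs (iC R) = 1.
Proof. by apply/eqP; rewrite -(@eqrXn2 _ 2%N)// ?cabs_ge0// sqr_cabs /= expr0n /= add0r. Qed.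

(** If the real part [x] of [e^(-it) z] is close to [|z|], then its imaginary
    part [y] is small, since [x cos p + y sin p] and [x cos p - y sin p] do not
    exceed [|z|] for a small angle [p].  So [D z] is close to [e^(it) D |z|]. *)
Let near_direction z e : 0 < e -> e <= 1 -> exists2 K : R, 0 < K & forall t,
  lev (vmod (D z - cis t *: d (vmod z)))
      (K *: G (vmod z - vdir t z) + (2 * e) *: G (vmod z)).
Proof.
move=> e0 e1; have [p [/andP[p0 ppi] sp0 cp0 cpe sp2]] := small_angle e0 e1.
exists (1 + 2 * (cos p / sin p)).
  by rewrite ltr_wpDr// mulr_ge0// divr_ge0// ltW.
move=> t; set a := vmod z; pose z' := cis (- t) *: z.
have az : vmod z' = a by rewrite vmod_cis.
have zz : z = cis t *: z' by rewrite scalerA -cisD subrr /cis cos0 sin0 scale1r.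
have xE : vdir t z = vRe z' by rewrite -vdir0 vdir_cis sub0r opprK.
rewrite xE; set x := vRe z'; set y := vIm z'.
have a0 : lev 0 a by exact: vmod_ge0.
have ax0 : lev 0 (a - x).
  by apply: (lev_eq1 (levT (absv_ge x) (vRe_abs z'))); rewrite az; module.
have -> : D z - cis t *: d a = cis t *: (d (x - a) + iC R *: d y).
  have -> : D z = cis t *: (d x + iC R *: d y) by rewrite {1}zz linearZ /= (Dre z').
  by rewrite /= vrealB linearB /=; cmodule.
rewrite vmod_cis; apply: (levT (vmodD _ _)); rewrite vmodZ cabs_iC scale1r.
have h1 : lev (G (x - a)) (G (a - x)).
  by rewrite -GN opprB; exact: lev_refl.
have hy : lev (absv y) ((cos p / sin p) *: (a - x) + e *: a).
  have si : 0 <= (sin p)^-1 by rewrite invr_ge0 ltW.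
  have u1 := vdir_le p z'; have u2 := vdir_le (- p) z'.
  rewrite /vdir cosN sinN az -/x -/y in u1 u2.
  have ee : e = (1 - cos p) / sin p by rewrite cpe mulfK// gt_eqF.
  apply: absv_le.
    by apply: (lev_eq1 (lev_scale si u1)); rewrite ee; module_over (R : comPzRingType) ltac:(by field; rewrite gt_eqF).
  by apply: (lev_eq1 (lev_scale si u2)); rewrite ee; module_over (R : comPzRingType) ltac:(by field; rewrite gt_eqF).
have q0 : 0 <= cos p / sin p by rewrite divr_ge0// ltW.
have h2 := absop_abs dD dZ db dd y.
have h3 := GS (absv_ge0 y) hy.
have h4 := GD ((cos p / sin p) *: (a - x)) (e *: a).
rewrite !GZ ?(ltW e0)// in h4.
have h5 := lev_scale (_ : 0 <= 2 :> R) (levT h3 h4).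
apply: (lev_eq3 h1 h2 (h5 _)) => //.
by rewrite -/(absop D y) -/(absop D (absv y)); module.
Qed.

(** Finitely many directional real parts of [z] already come close to [|z|],
    and [G] commutes with finite meets; it need not commute with the infinite
    supremum that defines [|z|]. *)
Let inf_direction z f K e : 0 < K -> 0 < e -> e <= 1 ->
  (forall t, lev f (K *: G (vmod z - vdir t z))) ->
  lev f (K *: ((3 * e) *: G (vmod z))).
Proof.
move=> K0 e0 e1 hf; have [n [th hth]] := cis_net e0 e1.
set a := vmod z.
have a0 : lev 0 a by exact: vmod_ge0.
have x0 t : lev 0 (a - vdir t z).
  by apply: (lev_eq1 (vdir_le t z)); rewrite -/a; module.
pose fix mm i : E := if i is j.+1 then meetv (mm j) (a - vdir (th j) z) else 2 *: a.
have mm0 i : lev 0 (mm i).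
  by elim: i => [|i IH] /=; [apply: lev_scale0|exact: meetv_ge0].
have mm_le i j : (i < j)%N -> lev (mm j) (a - vdir (th i) z).
  elim: j => //= j IH; rewrite ltnS leq_eqVlt => /predU1P[->|ij]; first exact: levIr.
  exact: levT (levIl _ _) (IH ij).
have fm i : lev f (K *: G (mm i)).
  elim: i => [|i IH] /=.
    apply: (levT (hf 0)); apply: lev_scale; first exact: ltW.
    apply: GS => //; have := levT (absv_geN _) (vdir_abs 0 z); rewrite -/a => h.
    by apply: (lev_eq1 h); module.
  apply: (@levT _ _ (K *: meetv (G (mm i)) (G (a - vdir (th i) z)))).
    by rewrite -meetvZ//; exact: levI.
  by apply: lev_scale; [exact: ltW|exact: GI].
apply: (levT (fm n)).
apply: lev_scale; first exact: ltW.
have e3 : 0 <= 3 * e by rewrite mulr_ge0// ltW.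
rewrite -GZ//; apply: GS => //.
suff h : lev a (a + (3 * e) *: a - mm n) by apply: (lev_eq1 h); module.
apply: vmod_le => t.
have [i [dl [[j jn ij] ct sdl cdl sdl2]]] := hth t.
have vE : vdir t z = vdir (i + dl) z by rewrite /vdir; case: ct => -> ->.
pose z' := cis (- i) *: z.
have az : vmod z' = a by rewrite vmod_cis.
have iE : vdir i z = vRe z' by rewrite -vdir0 vdir_cis sub0r opprK.
have dE : vdir (i + dl) z = cos dl *: vRe z' + sin dl *: vIm z'.
  by rewrite -[RHS]/(vdir dl z') vdir_cis opprK addrC.
have h1 := mm_le j n jn; rewrite -ij iE in h1.
have h2 := levT (absv_geN _) (vRe_abs z'); rewrite az in h2.
have h3 := levT (absv_ge _) (vIm_abs z'); rewrite az in h3.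
have cd1 : 0 <= 1 - cos dl.
  by have := cos2Dsin2 dl; have := sqr_ge0 (sin dl); nra.
have h4 := lev_scale cd1 h2; have h5 := lev_scale sdl h3.
have h6 : lev ((1 - cos dl) *: a + sin dl *: a) ((3 * e) *: a).
  by rewrite -scalerDl; apply: lev_scale2 => //; lra.
rewrite vE dE; apply: (lev_eq2 (lev_add h1 h6) (lev_add h4 h5)); module.
Qed.

(** [|D z|] and [|D |z||] differ by little in every direction in which [z] is
    nearly positive, and such directions cover everything. *)
Lemma vmod_absop z : vmod (D z) = G (vmod z).
Proof.
set a := vmod z.
have key f g : (forall e K, 0 < e -> e <= 1 -> 0 < K ->
     (forall t, lev (vmod (D z - cis t *: d a)) (K *: G (a - vdir t z) + (2 * e) *: G a)) ->
     forall t, lev (f - g) (K *: G (a - vdir t z) + (2 * e) *: G a)) -> lev f g.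
  move=> h; apply: (@lev_arch _ _ _ _ (G a)) => e e0.
  pose e' := Num.min 1 (e / 4).
  have e'0 : 0 < e' by rewrite lt_min ltr01/= divr_gt0.
  have e'1 : e' <= 1 by rewrite ge_min lexx.
  have e'e : e' <= e / 4 by rewrite ge_min lexx orbT.
  have [K K0 hK] := near_direction z e'0 e'1.
  have {h}h := h _ _ e'0 e'1 K0 hK.
  pose e2 := Num.min 1 (e / (6 * K)).
  have e20 : 0 < e2 by rewrite lt_min ltr01/= divr_gt0// mulr_gt0.
  have e21 : e2 <= 1 by rewrite ge_min lexx.
  have e2e : e2 <= e / (6 * K) by rewrite ge_min lexx orbT.
  have h' t : lev (f - g - (2 * e') *: G a) (K *: G (a - vdir t z)).
    by apply: (lev_eq1 (h t)); module.
  have hh := inf_direction K0 e20 e21 h'; rewrite -/a in hh.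
  have ke : K * (3 * e2) + 2 * e' <= e.
    have : K * (3 * e2) <= e / 2.
      have -> : e / 2 = K * (3 * (e / (6 * K))) by field; rewrite gt_eqF.
      by rewrite ler_pM2l// ler_pM2l.
    by lra.
  have := lev_scale2 ke (absop_ge0 a) => h3.
  by apply: (lev_eq2 hh h3); module.
have flip t x y : vmod x = vmod (cis t *: x) by rewrite vmod_cis.
apply: lev_anti; apply: key => e K e0 e1 K0 h t; apply: levT (h t).
  have := vmodD (D z - cis t *: d a) (cis t *: d a).
  rewrite subrK vmod_cis -/(absop D a) => h1.
  by apply: (lev_eq1 h1); module.
have := vmodD (cis t *: d a - D z) (D z).
rewrite subrK vmod_cis -/(absop D a) vmodB => h1.
by apply: (lev_eq1 h1); module.
Qed.

Lemma absop_mono u v : lev 0 u -> lev u v -> lev (G u) (G v).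
Proof. exact: GS. Qed.

(** [|p| + |q|] is the supremum of the real parts of [e^(-is) p + e^(-it) q],
    and for [p = D u], [q = D v] these are bounded by the modulus of the image
    of [u + e^(i(s - t)) v]. *)
Lemma absop_add u v : lev 0 u -> lev 0 v -> G (u + v) = G u + G v.
Proof.
move=> u0 v0; apply: lev_anti; first exact: GD.
have h s t : lev (vdir s (d u) + vdir t (d v)) (G (u + v)).
  have -> : vdir t (d v) = vdir s (cis (s - t) *: d v).
    by rewrite vdir_cis; congr vdir; ring.
  rewrite -vdirD; apply: (levT (vdir_le _ _)); rewrite -linearZ -linearD vmod_absop.
  apply: GS; first exact: vmod_ge0.
  by apply: (levT (vmodD _ _)); rewrite vmod_cis !vmod_pos//; exact: lev_refl.
have h2 : lev (G u) (G (u + v) - G v).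
  apply: vmod_le => s.
  suff : lev (G v) (G (u + v) - vdir s (d u)) by move=> h2; apply: (lev_eq1 h2); module.
  by apply: vmod_le => t; apply: (lev_eq1 (h s t)); module.
by apply: (lev_eq1 h2); module.
Qed.

Lemma absop_lip u v : `|G u - G v| <= c * `|u - v|.
Proof.
apply: (le_trans (rnorm_dist _ _)); rewrite -linearB -vrealB.
exact: db.
Qed.

Lemma absop_scale k u : 0 <= k -> G (k *: u) = k *: G u.
Proof. exact: GZ. Qed.

Lemma absop_meetv u v : lev 0 u -> lev 0 v -> meetv (G u) (G v) = G (meetv u v).
Proof.
move=> u0 v0; apply: lev_anti; first exact: GI.
have m0 := meetv_ge0 u0 v0.
by apply: levI; apply: GS => //; [exact: levIl|exact: levIr].
Qed.

End Operator.

(** * Weighted composition operators *)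

Section CentralIteration.
Variables (R : realType) (E : realBanachLatticeType R) (alpha : E -> E) (C : R).
Implicit Types (u v w : E) (i j : nat).
Hypothesis C0 : 0 < C.
Hypothesis alpha_ge0 : forall u, lev 0 u -> lev 0 (alpha u).
Hypothesis alphaD : forall u v, lev 0 u -> lev 0 v -> alpha (u + v) = alpha u + alpha v.
Hypothesis alphaZ : forall k u, 0 <= k -> alpha (k *: u) = k *: alpha u.
Hypothesis alpha_le : forall u, lev 0 u -> lev (alpha u) (C *: u).

Let beta u := u - C^-1 *: alpha u.
Let b j u := iter j beta u.

Let ci : 0 <= C^-1. Proof. by rewrite invr_ge0 ltW. Qed.

Let beta_ge0 u : lev 0 u -> lev 0 (beta u).
Proof.
move=> u0; apply: (lev_eq1 (lev_scale ci (alpha_le u0))).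
by rewrite /beta; module_over (R : comPzRingType) ltac:(by field; rewrite gt_eqF).
Qed.

Let beta_le u : lev 0 u -> lev (beta u) u.
Proof. by move=> u0; apply: (lev_eq1 (lev_scale0 ci (alpha_ge0 u0))); rewrite /beta; module. Qed.

Let betaD u v : lev 0 u -> lev 0 v -> beta (u + v) = beta u + beta v.
Proof. by move=> u0 v0; rewrite /beta alphaD//; module. Qed.

Let b_ge0 j u : lev 0 u -> lev 0 (b j u).
Proof. by move=> u0; elim: j => //= j IH; exact: beta_ge0. Qed.

Let bD j u v : lev 0 u -> lev 0 v -> b j (u + v) = b j u + b j v.
Proof. by move=> u0 v0; elim: j => //= j ->; rewrite betaD//; exact: b_ge0. Qed.

Let bS j u v : lev 0 u -> lev u v -> lev (b j u) (b j v).
Proof.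
move=> u0 uv; have vu : lev 0 (v - u) by apply: (lev_eq1 uv); module.
have -> : v = u + (v - u) by module.
by rewrite bD//; apply: lev_addr; exact: b_ge0.
Qed.

Let alpha_mono u v : lev 0 u -> lev u v -> lev (alpha u) (alpha v).
Proof.
move=> u0 uv; have vu : lev 0 (v - u) by apply: (lev_eq1 uv); module.
have -> : v = u + (v - u) by module.
by rewrite alphaD//; apply: lev_addr; exact: alpha_ge0.
Qed.

Let alpha_sub u v : lev 0 v -> lev v u -> alpha (u - v) = alpha u - alpha v.
Proof.
move=> v0 vu; have h : lev 0 (u - v) by apply: (lev_eq1 vu); module.
by apply: (addIr (alpha v)); rewrite -alphaD// !subrK.
Qed.

Let beta_alpha u : lev 0 u -> beta (alpha u) = alpha (beta u).
Proof.
move=> u0; rewrite {2}/beta alpha_sub ?alphaZ//.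
  by apply: lev_scale0 => //; exact: alpha_ge0.
by apply: (lev_eq1 (beta_ge0 u0)); rewrite /beta; module.
Qed.

Let b_alpha j u : lev 0 u -> b j (alpha u) = alpha (b j u).
Proof. by move=> u0; elim: j => //= j ->; rewrite beta_alpha//; exact: b_ge0. Qed.

Let alphaE u : alpha u = C *: (u - beta u).
Proof. by rewrite /beta; module_over (R : comPzRingType) ltac:(by field; rewrite gt_eqF). Qed.

(** The differences [b j v - b j.+1 v] decrease, and they sum up to at most
    [v]. *)
Let telescope_le j v : lev 0 v -> lev (j.+1%:R *: (b j v - b j.+1 v)) (v - b j.+1 v).
Proof.
move=> v0; elim: j => [|j IH]; first by rewrite scale1r; exact: lev_refl.
have dec : lev (b j.+1 v - b j.+2 v) (b j v - b j.+1 v).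
  have e i : b i v - b i.+1 v = C^-1 *: alpha (b i v).
    by rewrite [b i.+1 v]/= -/(b i v) /beta; module.
  rewrite !e; apply: lev_scale => //; apply: alpha_mono; first exact: b_ge0.
  by apply: beta_le; exact: b_ge0.
have j0 : 0 <= j.+1%:R :> R by [].
by apply: (lev_eq2 IH (lev_scale j0 dec)); rewrite -(addn1 j.+1) natrD; module.
Qed.

(** Partial sums of [C^-1 (1 - beta)^-1 u = alpha^-1 u]. *)
Fixpoint neumann u j : E := if j is i.+1 then neumann u i + C^-1 *: b i u else 0.

(** The partial sums [w] of the Neumann series for the inverse of [alpha]
    satisfy [alpha w = u - b j u], with [b j u <= b j (alpha v)], and
    [b j (alpha v)] is [C] times a difference bounded by [v / (j + 1)].  The
    operator [alpha] itself need not be injective. *)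
Lemma central_interval u v eps : lev 0 u -> lev 0 v -> lev u (alpha v) -> 0 < eps ->
  exists w, [/\ lev 0 w, lev w v & `|alpha w - u| <= eps].
Proof.
move=> u0 v0 uv eps0.
pose j := Num.truncn (eps^-1 * (C * `|v|)).
have n0 i : lev 0 (neumann u i).
  elim: i => [|i IH] /=; first exact: lev_refl.
  by apply: lev_add0 => //; apply: lev_scale0 => //; exact: b_ge0.
have nE i : alpha (neumann u i) = u - b i u.
  elim: i => [|i IH] /=.
    by have := @alphaZ 0 0 (lexx 0); rewrite !scale0r => ->; rewrite subrr.
  have bi0 := b_ge0 i u0.
  rewrite alphaD ?IH//; last by apply: lev_scale0.
  by rewrite alphaZ// alphaE -/(b i u); module_over (R : comPzRingType) ltac:(by field; rewrite gt_eqF).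
have bu i : lev (b i u) (C *: (b i v - b i.+1 v)).
  by apply: (levT (bS i u0 uv)); rewrite b_alpha// alphaE; exact: lev_refl.
exists (neumann u j.+1); split => //.
  suff h i : lev (neumann u i) (v - b i v).
    by apply: (lev_eq2 (h j.+1) (b_ge0 j.+1 v0)); module.
  elim: i => [|i IH]; first by rewrite subrr; exact: lev_refl.
  apply: (lev_eq2 IH (lev_scale ci (bu i))).
  by rewrite [neumann _ _]/=; module_over (R : comPzRingType) ltac:(by field; rewrite gt_eqF).
rewrite nE; have -> : u - b j.+1 u - u = - b j.+1 u by module.
rewrite normrN.
have j0 : 0 < j.+2%:R :> R by [].
have ij : 0 <= j.+2%:R^-1 :> R by rewrite invr_ge0.
have h1 := lev_scale ij (telescope_le j.+1 v0).
have h2 : lev (b j.+1 u) ((C / j.+2%:R) *: v).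
  have h3 := lev_scale (_ : 0 <= C / j.+2%:R) (b_ge0 j.+2 v0); rewrite scaler0 in h3.
  apply: (lev_eq3 (bu j.+1) (lev_scale (ltW C0) h1) (h3 _)); first by rewrite divr_ge0// ltW.
  module_over (R : comPzRingType) ltac:(by field; rewrite gt_eqF).
apply: (le_trans (lev_norm_ge0 (b_ge0 _ u0) h2)).
rewrite normrZ gtr0_norm ?divr_gt0//.
rewrite mulrAC ler_pdivrMr// mulrC -ler_pdivrMl// mulrC.
apply: ltW; apply: (lt_le_trans (truncnS_gt _)).
by rewrite ler_nat.
Qed.

End CentralIteration.

Section WeightedComposition.
Variables (R : realType) (E : realBanachLatticeType R) (X : complexBanachLatticeType E).
Implicit Types (x y z : X) (u v w : E) (k : R).

Lemma bounded_rnorm (F : X -> X) : bounded_on setT F ->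
  exists2 c : R, 0 <= c & forall x, rnorm (F x) <= c * rnorm x.
Proof.
move=> [c hc]; exists `|c| => // x; have := hc x I; rewrite !rnormE -rmorphM lecR => h.
by apply: (le_trans h); rewrite ler_wpM2r ?rnorm_ge0 ?ler_norm.
Qed.

Lemma center_rnorm (F : X -> X) : in_center F ->
  exists2 c : R, 0 <= c & forall x, rnorm (F x) <= c * rnorm x.
Proof.
move=> [c c0 hc]; exists c => // x; rewrite !rnorm_vmod; apply: (le_trans (lev_norm_ge0 (vmod_ge0 _) (hc x))).
by rewrite normrZ ger0_norm.
Qed.

Lemma center_disj (F : X -> X) : in_center F ->
  forall x y, disjointv x y -> disjointv (F x) (F y).
Proof.
move=> [c c0 hc] x y xy.
apply: (@disj_le2 _ _ (c *: vmod x) (c *: vmod y)); rewrite ?vmod_ge0//; try exact: vmod_ge0.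
have x0 := vmod_ge0 x; have y0 := vmod_ge0 y.
apply: disjZ => //; last exact: lev_scale0.
by rewrite meetvC; apply: disjZ => //; rewrite meetvC.
Qed.

Variables S A T : {linear X -> X}.
Hypotheses (hS : d_isomorphism S) (hA : in_center A) (hT : forall x, T x = A (S x)).

Lemma weighted_rnorm : exists2 c : R, 0 <= c & forall x, rnorm (T x) <= c * rnorm x.
Proof.
have [sb _ _] := hS; have [c c0 hc] := bounded_rnorm sb; have [a a0 ha] := center_rnorm hA.
exists (a * c) => [|x]; first exact: mulr_ge0.
by rewrite hT; apply: (le_trans (ha _)); rewrite -mulrA ler_wpM2l.
Qed.

Lemma weighted_disj x y : disjointv x y -> disjointv (T x) (T y).
Proof.
by move=> xy; rewrite !hT; apply: center_disj => //; have [_ _] := hS; apply.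
Qed.

(** Only the central factor requires an approximation: [S] is onto and
    [absop S] preserves meets, so that it maps the interval from [0] to [v] onto
    the interval from [0] to [absop S v]. *)
Lemma weighted_interval u v eps : lev 0 u -> lev 0 v -> lev u (absop T v) -> 0 < eps ->
  exists w, [/\ lev 0 w, lev w v & `|absop T w - u| <= eps].
Proof.
move=> u0 v0 uv eps0.
have [sb [V [_ _ _ VS]] sd] := hS.
have [cs cs0 hcs] := bounded_rnorm sb.
have [ca ca0 hca] := center_rnorm hA.
have ad := center_disj hA.
have TE x : vmod (T x) = absop A (vmod (S x)) by rewrite hT (vmod_absop hca ad).
have [c c0 hc] := hA.
have sv0 : lev 0 (absop S v) by exact: vmod_ge0.
have usv : lev u (absop A (absop S v)) by rewrite -TE.
have [w' [w'0 w'v w'e]] : exists w, [/\ lev 0 w, lev w (absop S v) & `|absop A w - u| <= eps].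
  apply: (@central_interval R E (absop A) (c + 1)) => //.
  - by rewrite ltr_wpDl.
  - by move=> x _; exact: vmod_ge0.
  - by move=> x y x0 y0; exact: (absop_add hca ad).
  - by move=> k x k0; exact: absop_scale.
  - by move=> x x0; apply: (levT (hc _)); rewrite vmod_pos//; apply: lev_scale2 => //; lra.
pose x := V (vreal w').
have Sx : S x = vreal w' by apply: VS; rewrite inE.
have sx : absop S (vmod x) = w' by rewrite -(vmod_absop hcs sd) Sx vmod_pos.
have x0 := vmod_ge0 x.
(* Cutting [|x|] down to [v] does not change its image, which is below that
of [v]. *)
exists (meetv (vmod x) v); split; [exact: meetv_ge0|exact: levIr|].
rewrite /absop TE -/(absop S _) -(absop_meetv hcs sd)// sx meetv_l//.
Qed.

Lemma iter_absop n z : vmod (iter n T z) = iter n (absop T) (vmod z).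
Proof.
have [c c0 hc] := weighted_rnorm.
by elim: n => //= n <-; rewrite (vmod_absop hc weighted_disj).
Qed.

Lemma iter_absop_mono n u v : lev 0 u -> lev u v ->
  lev (iter n (absop T) u) (iter n (absop T) v).
Proof.
have [c c0 hc] := weighted_rnorm; move=> u0 uv.
suff [] : lev 0 (iter n (absop T) u) /\ lev (iter n (absop T) u) (iter n (absop T) v) by [].
elim: n => //= n [IH0 IH]; split; first exact: vmod_ge0.
exact: (absop_mono hc weighted_disj).
Qed.

Lemma iter_absop_lip : exists2 c : R, 0 <= c & forall n u v,
  `|iter n (absop T) u - iter n (absop T) v| <= c ^+ n * `|u - v|.
Proof.
have [c c0 hc] := weighted_rnorm; exists c => // n u v.
elim: n => /= [|n IH]; first by rewrite mul1r.
apply: (le_trans (absop_lip hc _ _)).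
by rewrite exprS -mulrA ler_wpM2l.
Qed.

Lemma iter_absop_interval n u v eps : lev 0 u -> lev 0 v -> lev u (iter n (absop T) v) ->
  0 < eps -> exists w, [/\ lev 0 w, lev w v & `|iter n (absop T) w - u| <= eps].
Proof.
have [c c0 hc] := weighted_rnorm => + v0.
elim: n u eps => /= [|n IH] u eps u0 uv eps0.
  by exists u; rewrite subrr normr0 ltW.
have w0 : lev 0 (iter n (absop T) v) by case: (n) => //= m; exact: vmod_ge0.
have e20 : 0 < eps / 2 by rewrite divr_gt0.
have [w1 [w10 w1v w1e]] := weighted_interval u0 w0 uv e20.
have e30 : 0 < eps / 2 / (c + 1) by rewrite !divr_gt0// ltr_wpDl.
have [w [w00 wv we]] := IH w1 _ w10 w1v e30.
exists w; split => //.
have := absop_lip hc (iter n (absop T) w) w1 => h1.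
apply: (le_trans (ler_distD (absop T w1) _ _)).
have h2 : c * `|iter n (absop T) w - w1| <= eps / 2.
  apply: (le_trans (ler_wpM2l c0 we)); rewrite mulrC mulrAC ler_pdivrMr ?ltr_wpDl//.
  by nra.
by lra.
Qed.

End WeightedComposition.

(** * Closed subspaces of Banach spaces and resolvents *)

Section RealSequences.
Variable R : realType.

Lemma geometric_small (C q e : R) : 0 <= q -> q < 1 -> 0 < e ->
  exists n, forall m, (n <= m)%N -> C * q ^+ m <= e.
Proof.
move=> q0 q1 e0.
have d0 : 0 < e / (1 + `|C|) by rewrite divr_gt0// ltr_wpDr.
have q1' : `|q| < 1 by rewrite ger0_norm.
have /cvgr0_norm_lt /(_ _ d0) [n _ hn] := cvg_expr q1'.
exists n => m nm; have := hn m nm; rewrite ger0_norm ?exprn_ge0// ltr_pdivlMr ?ltr_wpDr// => h.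
apply: ltW; apply: le_lt_trans h; rewrite mulrC ler_wpM2l ?exprn_ge0//.
by rewrite ler_wpDl// ler_norm.
Qed.

End RealSequences.

Section BanachSubspace.
Variables (R : realType) (V : completeNormedModType R[i]) (Y : set V).
Implicit Types (x y z : V) (n m : nat) (e C q : R).
Hypothesis Yclosed : closed Y.

Lemma closed_rnorm x : (forall e, 0 < e -> exists2 y, Y y & rnorm (y - x) <= e) -> Y x.
Proof.
move=> h; apply: Yclosed => B /nbhs_ballP[_/posnumP[eps] hB].
have [e e0 ee] : exists2 e : R, 0 < e & eps%:num = e%:C.
  have := [gt0 of eps%:num]; case: (eps%:num) => a b; rewrite ltcE /= => /andP[/eqP -> a0].
  by exists a.
have e20 : 0 < e / 2 by rewrite divr_gt0.
have [y Yy ye] := h _ e20; exists y; split => //; apply: hB.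
rewrite -ball_normE /= ee rnormE ltcR rnormB; apply: (le_lt_trans ye).
by rewrite ltr_pdivrMr// ltr_pMr// ltr1n.
Qed.

Lemma geometric_limit (x : nat -> V) C q : 0 <= q -> q < 1 ->
  (forall n, Y (x n)) -> (forall n, rnorm (x n.+1 - x n) <= C * q ^+ n) ->
  exists2 l, Y l & forall n, rnorm (x n - l) <= C / (1 - q) * q ^+ n.
Proof.
move=> q0 q1 Yx hx.
have q10 : 0 < 1 - q by rewrite subr_gt0.
have C0 : 0 <= C by have := le_trans (rnorm_ge0 _) (hx 0); rewrite expr0 mulr1.
have dist n m : rnorm (x (n + m)%N - x n) <= C / (1 - q) * q ^+ n.
  suff h : rnorm (x (n + m)%N - x n) <= C / (1 - q) * (q ^+ n - q ^+ (n + m)).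
    apply: (le_trans h); rewrite ler_wpM2l ?divr_ge0 ?(ltW q10)//.
    by rewrite lerBlDr lerDl exprn_ge0.
  elim: m => [|m IH]; first by rewrite addn0 !subrr rnorm0 mulr0.
  rewrite addnS; apply: (le_trans (rnorm_triangle (x (n + m)%N) _ _)).
  apply: (le_trans (lerD (hx _) IH)); rewrite exprS le_eqVlt; apply/orP; left.
  by apply/eqP; field; rewrite gt_eqF.
have small e : 0 < e -> exists n, forall m, (n <= m)%N -> C / (1 - q) * q ^+ m <= e.
  exact: geometric_small.
have cv : cvg (x @ \oo).
  apply/cauchy_cvgP; apply: cauchy_exP => eps eps0.
  have [e e0 ee] : exists2 e : R, 0 < e & eps = e%:C.
    move: eps0; case: eps => a b; rewrite ltcE /= => /andP[/eqP -> a0].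
    by exists a.
  have e20 : 0 < e / 2 by rewrite divr_gt0.
  have [n hn] := small _ e20.
  exists (x n); exists n => // m /= nm.
  rewrite -ball_normE /= ee rnormE ltcR rnormB -(subnKC nm).
  apply: (le_lt_trans (dist _ _)); apply: (le_lt_trans (hn n (leqnn _))).
  by rewrite ltr_pdivrMr// ltr_pMr// ltr1n.
pose l := lim (x @ \oo).
have near_l e : 0 < e -> exists n, forall m, (n <= m)%N -> rnorm (x m - l) <= e.
  move=> e0; have eC : 0 < e%:C by rewrite ltcR.
  have /cvgrPdist_lt /(_ _ eC) [n _ hn] := cv.
  exists n => m nm; have := hn m nm; rewrite rnormE ltcR rnormB; exact: ltW.
exists l.
  apply: closed_rnorm => e e0; have [n hn] := near_l _ e0.
  by exists (x n) => //; exact: hn.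
move=> n; apply/ler_addgt0Pl => e e0; have [m hm] := near_l _ e0.
apply: (le_trans (rnorm_triangle (x (n + m)%N) _ _)); rewrite addrC lerD//.
  by apply: hm; exact: leq_addl.
by rewrite rnormB.
Qed.

Hypothesis Y0 : Y 0.

Lemma contraction_fixpoint (g : V -> V) q : 0 <= q -> q < 1 ->
  (forall x, Y x -> Y (g x)) ->
  (forall x y, Y x -> Y y -> rnorm (g x - g y) <= q * rnorm (x - y)) ->
  exists2 x, Y x & g x = x.
Proof.
move=> q0 q1 gY gq.
pose x n := iter n g 0.
have Yx n : Y (x n) by elim: n => //= n IH; exact: gY.
have hx n : rnorm (x n.+1 - x n) <= rnorm (g 0) * q ^+ n.
  elim: n => [|n IH]; first by rewrite /x /= subr0 expr0 mulr1.
  rewrite [x n.+2]/= [in X in _ - X]/x /= -/(x n.+1) -/(x n).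
  apply: (le_trans (gq _ _ (Yx n.+1) (Yx n))).
  by rewrite exprS mulrCA ler_wpM2l.
have [l Yl hl] := geometric_limit q0 q1 Yx hx.
exists l => //; apply/eqP; rewrite -subr_eq0; apply/eqP; apply: rnorm_small => e e0.
have e20 : 0 < e / 2 by rewrite divr_gt0.
have [n hn] := geometric_small (rnorm (g 0) / (1 - q)) q0 q1 e20.
apply: (le_trans (rnorm_triangle (x n.+1) _ _)).
have h1 := le_trans (hl n.+1) (hn n.+1 (leqnSn n)).
have h2 : rnorm (g l - x n.+1) <= e / 2.
  apply: (le_trans (gq _ _ Yl (Yx n))); rewrite rnormB.
  have h3 := le_trans (hl n) (hn n (leqnn n)).
  by apply: le_trans h3; rewrite ler_piMl ?rnorm_ge0 ?ltW.
by lra.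
Qed.

End BanachSubspace.

Section Resolvent.
Variables (R : realType) (V : completeNormedModType R[i]) (Y : set V) (T : {linear V -> V}).
Implicit Types (x y z : V) (i j k n m : nat) (e C K M q : R) (lam mu : R[i]).
Hypothesis Yclosed : closed Y.
Hypothesis Y0 : Y 0.
Hypothesis Ylin : forall a x y, Y x -> Y y -> Y (a *: x + y).
Hypothesis TY : forall x, Y x -> Y (T x).

(** Bounded invertibility on [Y], without reference to an inverse map. *)
Definition inverse_bounded (F : V -> V) C :=
  (forall y, Y y -> exists2 x, Y x & F x = y) /\
  (forall x, Y x -> rnorm x <= C * rnorm (F x)).

Local Notation RB lam C := (inverse_bounded (fun y => lam *: y - T y) C).

Lemma sub_addr x y : Y x -> Y y -> Y (x + y).
Proof. by move=> hx hy; rewrite -[x]scale1r; exact: Ylin. Qed.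
Lemma sub_scale a x : Y x -> Y (a *: x).
Proof. by move=> hx; rewrite -[a *: x]addr0; exact: Ylin. Qed.
Lemma sub_subr x y : Y x -> Y y -> Y (x - y).
Proof. by move=> hx hy; apply: sub_addr => //; rewrite -scaleN1r; exact: sub_scale. Qed.

Lemma inverse_boundedW F C C' : inverse_bounded F C -> C <= C' -> inverse_bounded F C'.
Proof.
move=> [h1 h2] CC; split => // x Yx; apply: (le_trans (h2 x Yx)).
by rewrite ler_wpM2r ?rnorm_ge0.
Qed.

Lemma inverse_choice F C : inverse_bounded F C ->
  exists G : V -> V, forall y, Y y -> Y (G y) /\ F (G y) = y.
Proof.
move=> [h _].
have /choice[G hG] : forall y, exists x, Y y -> Y x /\ F x = y.
  by move=> y; have [/h[x Yx e]|nY] := pselect (Y y); [exists x|exists 0 => /nY].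
by exists G.
Qed.

(** The equation [mu x - T x = y] is solved by iterating the inverse of
    [lam - T] on [y + (lam - mu) x]. *)
Lemma inverse_bounded_perturb lam mu M : RB lam M -> cabs (mu - lam) * M <= 1 / 2 ->
  RB mu (2 * M).
Proof.
move=> rb h; have [h1 h2] := rb; split; last first.
  move=> x Yx; have h3 := h2 x Yx.
  have [M0|M0] := leP 0 M; last first.
    have r1 := rnorm_ge0 x; have r2 := rnorm_ge0 (lam *: x - T x).
    have x0 : x = 0 by apply/eqP; rewrite -rnorm_eq0 eq_le r1 andbT; nra.
    by rewrite x0 rnorm0 scaler0 raddf0 subr0 rnorm0 mulr0.
  have h4 : rnorm (lam *: x - T x) <= rnorm (mu *: x - T x) + cabs (mu - lam) * rnorm x.
    have -> : lam *: x - T x = (mu *: x - T x) - (mu - lam) *: x by cmodule.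
    by apply: (le_trans (rnormD _ _)); rewrite rnormN rnormZ.
  have h5 := ler_wpM2l M0 h4; have := ler_wpM2r (rnorm_ge0 x) h; lra.
move=> y Yy; have [G hG] := inverse_choice rb.
pose g x := G (y + (lam - mu) *: x).
have Yarg x : Y x -> Y (y + (lam - mu) *: x).
  by move=> Yx; apply: sub_addr => //; exact: sub_scale.
have [||||x Yx ex] := @contraction_fixpoint _ _ _ Yclosed Y0 g (1 / 2).
- by [].
- by lra.
- by move=> x Yx; have [] := hG _ (Yarg x Yx).
- move=> x x' Yx Yx'; have [Y1 e1] := hG _ (Yarg x Yx); have [Y2 e2] := hG _ (Yarg x' Yx').
  have := h2 _ (sub_subr Y1 Y2).
  have -> : lam *: (g x - g x') - T (g x - g x') = (lam - mu) *: (x - x').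
    rewrite (linearB T).
    have -> : (lam - mu) *: (x - x') = (y + (lam - mu) *: x) - (y + (lam - mu) *: x') by cmodule.
    by rewrite -e1 -e2 /g; cmodule.
  rewrite rnormZ cabsB => h3; apply: (le_trans h3); rewrite mulrA (mulrC M).
  by rewrite ler_wpM2r ?rnorm_ge0.
exists x => //; have [_] := hG _ (Yarg x Yx); rewrite -/(g x) ex => e.
have -> : mu *: x - T x = (lam *: x - T x) - (lam - mu) *: x by cmodule.
by rewrite e; cmodule.
Qed.

(** Invertibility with a bound is an open condition and the circle is compact. *)
Lemma circle_uniform : (forall lam, cabs lam = 1 -> exists C, RB lam C) ->
  exists2 M, 1 <= M & forall lam, cabs lam = 1 -> RB lam M.
Proof.
move=> h.
have /compact_near_coveringP cpt := @segment_compact R (- pi) pi.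
have [] := cpt R (+oo)%R (fun M t => RB (cis t) M).
  move=> t _; have [C hC] := h _ (cabs_cis t).
  pose M := Num.max 1 C.
  have M1 : 1 <= M by rewrite le_max lexx.
  have hM : RB (cis t) M by apply: (inverse_boundedW hC); rewrite le_max lexx orbT.
  have M0 : 0 < M by apply: lt_le_trans M1.
  have d0 : 0 < (4 * M)^-1 by rewrite invr_gt0 mulr_gt0.
  have hc : \forall t' \near t, `|cos t' - cos t| < (4 * M)^-1.
    have /cvgrPdist_lt /(_ _ d0) := @continuous_cos R t.
    by apply: filterS => t'; rewrite distrC.
  have hs : \forall t' \near t, `|sin t' - sin t| < (4 * M)^-1.
    have /cvgrPdist_lt /(_ _ d0) := @continuous_sin R t.
    by apply: filterS => t'; rewrite distrC.
  exists ([set t' | `|cos t' - cos t| < (4 * M)^-1 /\ `|sin t' - sin t| < (4 * M)^-1],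
          [set N | 2 * M <= N]).
    split; first exact: filterI.
    by exists (2 * M); split; [exact: num_real|move=> N; exact: ltW].
  move=> [t' N] /= [[c1 c2] MN]; apply: inverse_boundedW MN.
  apply: (inverse_bounded_perturb hM).
  have cc : cabs (cis t' - cis t) <= 2 * (4 * M)^-1.
    have a0 : 0 <= 2 * (4 * M)^-1 by rewrite mulr_ge0// ltW.
    rewrite -(@ler_pXn2r _ 2%N)// ?nnegrE ?cabs_ge0// sqr_cabs /=.
    move: c1 c2; rewrite !ltr_norml => /andP[? ?] /andP[? ?].
    by nra.
  apply: (le_trans (ler_wpM2r (ltW M0) cc)); rewrite le_eqVlt; apply/orP; left.
  by apply/eqP; field; rewrite gt_eqF.
move=> B [_ hB]; pose M := Num.max 1 (B + 1).
exists M; first by rewrite le_max lexx.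
move=> lam lam1; have [t tI ->] := cis_surj lam1; apply: (hB M) => //.
by rewrite lt_max ltrDl ltr01 orbT.
Qed.

Lemma annulus_uniform M lam : 1 <= M -> (forall lam, cabs lam = 1 -> RB lam M) ->
  `|cabs lam - 1| <= (4 * M)^-1 -> RB lam (2 * M).
Proof.
move=> M1 hM hl.
have M0 : 0 < M by apply: lt_le_trans M1.
have e4 : (4 * M)^-1 * M = 1 / 4 by field; rewrite gt_eqF.
have [t e] := polar lam.
apply: (@inverse_bounded_perturb (cis t)); first exact: hM (cabs_cis t).
have -> : lam - cis t = (cabs lam - 1)%:C * cis t by rewrite {1}e rmorphB /= mulrBl mul1r.
rewrite cabsM cabs_cis mulr1.
have -> : cabs (cabs lam - 1)%:C = `|cabs lam - 1|.
  by rewrite /cabs normc_def /= expr0n addr0 sqrtr_sqr.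
by have := ler_wpM2r (ltW M0) hl; lra.
Qed.

End Resolvent.

(** * Averages of the resolvent over a circle *)

Section RootsOfMinusOne.
Variable R : realType.
Implicit Types (k : nat).

(** Multiplying [lam] by this root of [-1] changes the sign of
    [lam ^+ (2 ^ k)]; it tends to [1], which makes the averages converge. *)
Definition zeta k : R[i] := cis (pi / 2 ^+ k).

Lemma zetaS k : zeta k.+1 ^+ 2 = zeta k.
Proof.
rewrite expr2 -cisD; congr cis; rewrite exprS; field.
by rewrite expf_neq0.
Qed.

Lemma zeta_root k : zeta k ^+ (2 ^ k) = -1.
Proof.
elim: k => [|k IH]; last by rewrite expnS exprM zetaS.
by rewrite /zeta expr0 divr1 /cis cospi sinpi; apply/eqP; rewrite eq_complex /= oppr0 !eqxx.
Qed.

(** [zeta k - 1 = (zeta k.+1 - 1) (zeta k.+1 + 1)], and the second factor has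
    modulus at least [sqrt 2 >= 7 / 5]. *)
Lemma zeta_dist k : cabs (zeta k - 1) <= 2 * (5 / 7) ^+ k.
Proof.
elim: k => [|k IH].
  by rewrite expr0 mulr1; apply: (le_trans (cabsD _ _)); rewrite cabsN cabs1 cabs_cis.
have e : zeta k - 1 = (zeta k.+1 - 1) * (zeta k.+1 + 1) by rewrite -zetaS; ring.
have c0 : 0 <= cos (pi / 2 ^+ k.+1 : R).
  apply: cos_ge0_pihalf; have p0 := pi_ge0 R.
  have h : pi / 2 ^+ k.+1 <= pi / 2 :> R.
    rewrite ler_wpM2l// lef_pV2 ?posrE ?exprn_gt0// exprS ler_peMr//.
    by apply: exprn_ege1; rewrite ler1n.
  by rewrite h andbT (@le_trans _ _ 0)// ?oppr_le0 divr_ge0// exprn_ge0.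
have h2 : 7 / 5 <= cabs (zeta k.+1 + 1).
  rewrite -(@ler_pXn2r _ 2%N)// ?nnegrE ?cabs_ge0 ?divr_ge0// sqr_cabs /=.
  by have := cos2Dsin2 (pi / 2 ^+ k.+1 : R); nra.
rewrite e cabsM in IH; rewrite exprS.
have := ler_wpM2l (cabs_ge0 (zeta k.+1 - 1)) h2; lra.
Qed.

End RootsOfMinusOne.

Section DyadicResolvent.
Variables (R : realType) (V : completeNormedModType R[i]) (Y : set V) (T : {linear V -> V}).
Implicit Types (x y z : V) (i j k n m : nat) (e C q : R) (lam mu : R[i]).
Hypothesis Yclosed : closed Y.
Hypothesis Y0 : Y 0.
Hypothesis Ylin : forall a x y, Y x -> Y y -> Y (a *: x + y).
Hypothesis TY : forall x, Y x -> Y (T x).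
Variable c : R.
Hypothesis c0 : 0 <= c.
Hypothesis Tc : forall x, rnorm (T x) <= c * rnorm x.

Local Notation RB lam C := (inverse_bounded Y (fun y => lam *: y - T y) C).

Lemma iter_lin n a x y : iter n T (a *: x + y) = a *: iter n T x + iter n T y.
Proof. by elim: n => //= n ->; rewrite linearP. Qed.
Lemma iter_add n x y : iter n T (x + y) = iter n T x + iter n T y.
Proof. by rewrite -[x]scale1r iter_lin !scale1r. Qed.
Lemma iter_zero n : iter n T 0 = 0.
Proof. by elim: n => //= n ->; rewrite linear0. Qed.
Lemma iter_scale n a x : iter n T (a *: x) = a *: iter n T x.
Proof. by rewrite -[a *: x]addr0 iter_lin iter_zero addr0. Qed.
Lemma iter_sub n x y : iter n T (x - y) = iter n T x - iter n T y.
Proof. by rewrite addrC -scaleN1r iter_lin scaleN1r addrC. Qed.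
Lemma iter_sub_closed n x : Y x -> Y (iter n T x).
Proof. by move=> Yx; elim: n => //= n IH; exact: TY. Qed.
Lemma iter_rnorm n x : rnorm (iter n T x) <= c ^+ n * rnorm x.
Proof.
elim: n => /= [|n IH]; first by rewrite expr0 mul1r.
by apply: (le_trans (Tc _)); rewrite exprS -mulrA ler_wpM2l.
Qed.

Let TZ a x : T (a *: x) = a *: T x. Proof. by rewrite linearZ. Qed.

Section Circle.
Variables (rho M : R) (inv : R[i] -> V -> V).
Hypothesis rho0 : 0 < rho.
Hypothesis M0 : 0 <= M.
Hypothesis hM : forall lam, cabs lam = rho -> RB lam M.
Hypothesis hinv : forall lam y, cabs lam = rho -> Y y ->
  Y (inv lam y) /\ lam *: inv lam y - T (inv lam y) = y.

(** The average of [w (w - T)^-1] over all [w] with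
    [w ^+ (2 ^ k) = lam ^+ (2 ^ k)]. *)
Fixpoint dyres k lam y : V :=
  if k is j.+1 then 2^-1 *: (dyres j lam y + dyres j (zeta R j * lam) y)
  else lam *: inv lam y.

Let W k lam y := (lam ^+ (2 ^ k))^-1 *: iter (2 ^ k) T y.

Let lam_neq0 lam : cabs lam = rho -> lam != 0.
Proof. by move=> h; rewrite -cabs_gt0 h. Qed.

Let zeta_rho k lam : cabs lam = rho -> cabs (zeta R k * lam) = rho.
Proof. by move=> h; rewrite cabsM cabs_cis mul1r. Qed.

Let W_add k lam x y : W k lam (x + y) = W k lam x + W k lam y.
Proof. by rewrite /W iter_add; cmodule. Qed.
Let W_sub k lam x y : W k lam (x - y) = W k lam x - W k lam y.
Proof. by rewrite /W iter_sub; cmodule. Qed.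
Let W_scale k lam a x : W k lam (a *: x) = a *: W k lam x.
Proof. by rewrite /W iter_scale; cmodule. Qed.
Let W_S k lam y : W k.+1 lam y = W k lam (W k lam y).
Proof.
rewrite /W iter_scale -iterD scalerA addnn -mul2n -expnS -invfM -exprD addnn -mul2n.
by rewrite -expnS.
Qed.
Let W_zeta k lam y : W k (zeta R k * lam) y = - W k lam y.
Proof. by rewrite /W exprMn zeta_root mulN1r invrN scaleNr. Qed.
Let W_Y k lam y : Y y -> Y (W k lam y).
Proof. by move=> Yy; apply: sub_scale => //; exact: iter_sub_closed. Qed.

Let inv_uniq lam x y : cabs lam = rho -> Y y -> Y x -> lam *: x - T x = y -> inv lam y = x.
Proof.
move=> hl Yy Yx ex; have [Yi ei] := hinv hl Yy; have [_ h] := hM hl.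
apply/eqP; rewrite -subr_eq0; apply/eqP; apply: rnorm_small => e e0.
apply: (le_trans (h _ (sub_subr Y0 Ylin Yi Yx))).
have -> : lam *: (inv lam y - x) - T (inv lam y - x) = 0.
  rewrite (linearB T).
  have -> : lam *: (inv lam y - x) - (T (inv lam y) - T x) =
    (lam *: inv lam y - T (inv lam y)) - (lam *: x - T x) by cmodule.
  by rewrite ei ex subrr.
by rewrite rnorm0 mulr0 ltW.
Qed.

Lemma dyres_closed k lam y : cabs lam = rho -> Y y -> Y (dyres k lam y).
Proof.
elim: k lam => /= [|k IH] lam hl Yy; first by apply: sub_scale => //; exact: (hinv hl Yy).1.
apply: sub_scale => //; apply: sub_addr => //; first exact: IH.
by apply: IH => //; exact: zeta_rho.
Qed.

Lemma dyres_lin k lam a x y : cabs lam = rho -> Y x -> Y y ->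
  dyres k lam (a *: x + y) = a *: dyres k lam x + dyres k lam y.
Proof.
elim: k lam => /= [|k IH] lam hl Yx Yy; last first.
  by rewrite !IH//; [cmodule|exact: zeta_rho].
have [Y1 e1] := hinv hl Yx; have [Y2 e2] := hinv hl Yy.
rewrite (@inv_uniq lam (a *: inv lam x + inv lam y)) //; last first.
- by rewrite (linearP T) -[in RHS]e1 -[in RHS]e2; cmodule.
- exact: Ylin.
- exact: Ylin.
by cmodule.
Qed.

(** Partial fractions: [1 / (1 - X^2)] is the mean of [1 / (1 - X)] and
    [1 / (1 + X)]. *)
Lemma dyres_inv_r k lam y : cabs lam = rho -> Y y ->
  dyres k lam y - W k lam (dyres k lam y) = y.
Proof.
elim: k lam => [|k IH] lam hl Yy.
  rewrite /W /= expn0 expr1 /=; have [_ e] := hinv hl Yy.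
  rewrite TZ scalerA mulVf ?scale1r//; exact: lam_neq0.
rewrite W_S [dyres _ _ _]/=.
set p := dyres k lam y; set q := dyres k (zeta R k * lam) y.
have hp : W k lam p = p - y by rewrite -[in RHS](IH lam hl Yy) -/p; cmodule.
have hq : W k lam q = y - q.
  have := IH _ (zeta_rho k hl) Yy; rewrite -/q W_zeta => e.
  by rewrite -[in RHS]e; cmodule.
have -> : W k lam (2^-1 *: (p + q)) = 2^-1 *: (p - q).
  by rewrite W_scale W_add hp hq; cmodule.
by rewrite W_scale W_sub hp hq; cmodule.
Qed.

Lemma dyres_inv_l k lam y : cabs lam = rho -> Y y ->
  dyres k lam (y - W k lam y) = y.
Proof.
elim: k lam y => [|k IH] lam y hl Yy.
  rewrite /= (@inv_uniq lam (lam^-1 *: y))//.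
  - by rewrite scalerA mulfV ?scale1r//; exact: lam_neq0.
  - by apply: sub_subr => //; exact: W_Y.
  - exact: sub_scale.
  rewrite /W expn0 expr1 /= TZ scalerA mulfV ?scale1r//; exact: lam_neq0.
rewrite W_S [LHS]/=.
have -> : y - W k lam (W k lam y) = (y + W k lam y) - W k lam (y + W k lam y).
  by rewrite W_add; cmodule.
rewrite IH//; last by apply: sub_addr => //; exact: W_Y.
have -> : y + W k lam y - W k lam (y + W k lam y) =
    (y - W k lam y) - W k (zeta R k * lam) (y - W k lam y).
  by rewrite W_zeta W_add W_sub; cmodule.
rewrite IH//; [cmodule|exact: zeta_rho|by apply: sub_subr => //; exact: W_Y].
Qed.

Let half : cabs (2^-1 : R[i]) = 2^-1.
Proof.
have -> : (2^-1 : R[i]) = (2^-1)%:C by rewrite fmorphV /= rmorph_nat.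
by rewrite cabs_real// invr_ge0.
Qed.

(** Up to the factor [lam ^+ j], applying [T ^ j] with [j < 2 ^ k] only puts
    unimodular weights on the terms of the average.  In the induction, the case
    [j >= 2 ^ k] rests on [X / (1 - X^2)] being half of the difference of
    [1 / (1 - X)] and [1 / (1 + X)]. *)
Lemma dyres_iter k lam y j : cabs lam = rho -> Y y -> (j < 2 ^ k)%N ->
  rnorm (iter j T (dyres k lam y)) <= rho * M * rho ^+ j * rnorm y.
Proof.
elim: k lam j => [|k IH] lam j hl Yy.
  rewrite expn0 ltnS leqn0 => /eqP -> /=; rewrite expr0 mulr1 rnormZ hl -mulrA.
  have [Yi e] := hinv hl Yy; have [_ h] := hM hl.
  by rewrite ler_pM2l//; have := h _ Yi; rewrite e.
have hz := zeta_rho k hl.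
have avg a b B : rnorm a <= B -> rnorm b <= B -> rnorm ((2^-1 : R[i]) *: (a + b)) <= B.
  move=> ha hb; rewrite rnormZ half; have := rnormD a b; lra.
rewrite [dyres _ _ _]/=; set p := dyres k lam y; set q := dyres k (zeta R k * lam) y.
have [jk _|kj jk] := ltnP j (2 ^ k).
  by rewrite iter_scale iter_add; apply: avg; apply: IH.
have ik : (j - 2 ^ k < 2 ^ k)%N.
  by rewrite ltn_subLR// addnn -mul2n -expnS.
rewrite -(subnK kj) iterD; set i := (j - 2 ^ k)%N.
have hp : W k lam p = p - y by rewrite -[in RHS](dyres_inv_r k hl Yy) -/p; cmodule.
have hq : W k lam q = y - q.
  have := dyres_inv_r k hz Yy; rewrite -/q W_zeta => e.
  by rewrite -[in RHS]e; cmodule.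
have -> : iter (2 ^ k) T (2^-1 *: (p + q)) = lam ^+ (2 ^ k) *: (2^-1 *: (p - q)).
  have -> : p - q = W k lam (p + q) by rewrite W_add hp hq; cmodule.
  rewrite -W_scale /W scalerA mulfV ?scale1r//.
  by rewrite expf_neq0//; exact: lam_neq0.
rewrite iter_scale rnormZ cabsX hl exprD.
have h : rnorm (iter i T ((2^-1 : R[i]) *: (p - q))) <= rho * M * rho ^+ i * rnorm y.
  by rewrite iter_scale iter_sub; apply: avg; [exact: IH|rewrite rnormN; exact: IH].
have := ler_wpM2l (exprn_ge0 (2 ^ k) (ltW rho0)) h; congr (_ <= _); ring.
Qed.

Let L := M + rho * M ^+ 2.

(** The resolvent identity gives the case [k = 0]; averaging preserves the
    constant. *)
Lemma dyres_lipschitz k lam mu y : cabs lam = rho -> cabs mu = rho -> Y y ->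
  rnorm (dyres k lam y - dyres k mu y) <= L * cabs (lam - mu) * rnorm y.
Proof.
elim: k lam mu => [|k IH] lam mu hl hm Yy /=; last first.
  have -> : 2^-1 *: (dyres k lam y + dyres k (zeta R k * lam) y) -
     2^-1 *: (dyres k mu y + dyres k (zeta R k * mu) y) =
     2^-1 *: ((dyres k lam y - dyres k mu y) +
     (dyres k (zeta R k * lam) y - dyres k (zeta R k * mu) y)) by cmodule.
  have h1 := IH _ _ hl hm Yy.
  have h2 := IH _ _ (zeta_rho k hl) (zeta_rho k hm) Yy.
  rewrite -mulrBr cabsM cabs_cis mul1r in h2.
  rewrite rnormZ half.
  by have := rnormD (dyres k lam y - dyres k mu y)
     (dyres k (zeta R k * lam) y - dyres k (zeta R k * mu) y); lra.
have [Y1 e1] := hinv hl Yy; have [Y2 e2] := hinv hm Yy.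
have [_ h1] := hM hl; have [_ h2] := hM hm.
have b1 := h1 _ Y1; rewrite e1 in b1.
have b2 := h2 _ (sub_subr Y0 Ylin Y1 Y2).
rewrite (linearB T) in b2.
have ee : mu *: (inv lam y - inv mu y) - (T (inv lam y) - T (inv mu y)) =
   (mu - lam) *: inv lam y.
  have -> : mu *: (inv lam y - inv mu y) - (T (inv lam y) - T (inv mu y)) =
    (lam *: inv lam y - T (inv lam y)) - (mu *: inv mu y - T (inv mu y)) +
    (mu - lam) *: inv lam y by cmodule.
  by rewrite e1 e2 subrr add0r.
rewrite ee rnormZ cabsB in b2.
have -> : lam *: inv lam y - mu *: inv mu y =
  (lam - mu) *: inv lam y + mu *: (inv lam y - inv mu y) by cmodule.
apply: (le_trans (rnormD _ _)); rewrite !rnormZ hm.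
have d0 := cabs_ge0 (lam - mu).
have b3 := ler_wpM2l d0 b1.
have b4 := ler_wpM2l (ltW rho0) (le_trans b2 (ler_wpM2l M0 b3)).
apply: (le_trans (lerD b3 b4)); rewrite /L le_eqVlt; apply/orP; left; apply/eqP; ring.
Qed.

(** The new half of the average is the old average turned by [zeta k]. *)
Lemma dyres_cauchy k lam y : cabs lam = rho -> Y y ->
  rnorm (dyres k.+1 lam y - dyres k lam y) <= L * rho * rnorm y * (5 / 7) ^+ k.
Proof.
move=> hl Yy /=.
have -> : 2^-1 *: (dyres k lam y + dyres k (zeta R k * lam) y) - dyres k lam y =
  2^-1 *: (dyres k (zeta R k * lam) y - dyres k lam y) by cmodule.
have h := dyres_lipschitz k (zeta_rho k hl) hl Yy.
rewrite rnormZ half.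
have e : zeta R k * lam - lam = (zeta R k - 1) * lam by ring.
rewrite e cabsM hl in h.
have L0 : 0 <= L by rewrite addr_ge0// mulr_ge0 ?(ltW rho0)// exprn_ge0.
have := zeta_dist R k => hz.
have h2 : L * (cabs (zeta R k - 1) * rho) * rnorm y <= L * (2 * (5 / 7) ^+ k * rho) * rnorm y.
  by rewrite ler_wpM2r ?rnorm_ge0// ler_wpM2l// ler_wpM2r// ltW.
have h3 := le_trans h h2.
rewrite ler_pdivrMl//; apply: (le_trans h3); rewrite le_eqVlt; apply/orP; left; apply/eqP; ring.
Qed.

Lemma dyres_limit : exists2 C : R, 0 <= C & forall lam y, cabs lam = rho -> Y y ->
  exists2 l, Y l & forall k, rnorm (dyres k lam y - l) <= C * (5 / 7) ^+ k * rnorm y.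
Proof.
have q1 : 5 / 7 < 1 :> R by lra.
have q0 : 0 <= 5 / 7 :> R by lra.
have L0 : 0 <= L by rewrite addr_ge0// mulr_ge0 ?(ltW rho0)// exprn_ge0.
exists (L * rho / (1 - 5 / 7)).
  by rewrite divr_ge0 ?mulr_ge0 ?(ltW rho0)// subr_ge0 ltW.
move=> lam y hl Yy.
have [||l Yl hl'] := geometric_limit Yclosed q0 q1 (x := fun k => dyres k lam y)
   (C := L * rho * rnorm y).
- by move=> k; exact: dyres_closed.
- by move=> k; exact: dyres_cauchy.
exists l => // k; apply: (le_trans (hl' k)); rewrite le_eqVlt; apply/orP; left; apply/eqP; field => //.
Qed.

End Circle.

End DyadicResolvent.

(** * Dichotomy for a spectrum that misses a circle *)

Section ExponentialDichotomy.
Variables (R : realType) (V : completeNormedModType R[i]) (Y : set V) (T : {linear V -> V}).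
Implicit Types (x y z : V) (i j k n m : nat) (e C K M q rho : R) (lam mu : R[i]).
Hypothesis Yclosed : closed Y.
Hypothesis Y0 : Y 0.
Hypothesis Ylin : forall a x y, Y x -> Y y -> Y (a *: x + y).
Hypothesis TY : forall x, Y x -> Y (T x).
Variable c : R.
Hypothesis c0 : 0 <= c.
Hypothesis Tc : forall x, rnorm (T x) <= c * rnorm x.

Local Notation RB lam C := (inverse_bounded Y (fun y => lam *: y - T y) C).

Lemma inverse_bounded_factor (F G H : V -> V) C g :
  (forall x, Y x -> Y (G x)) -> (forall x, Y x -> rnorm (G x) <= g * rnorm x) ->
  (forall x, Y x -> Y (F x)) ->
  (forall x, Y x -> H x = F (G x)) -> (forall x, Y x -> H x = G (F x)) ->
  inverse_bounded Y H C -> exists C', inverse_bounded Y F C'.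
Proof.
move=> GY Gg FY HFG HGF h.
have {}h : inverse_bounded Y H (Num.max 0 C).
  by apply: (inverse_boundedW h); rewrite le_max lexx orbT.
have C0 : 0 <= Num.max 0 C by rewrite le_max lexx.
exists (Num.max 0 C * g); have [h1 h2] := h; split.
  by move=> y Yy; have [x Yx ex] := h1 y Yy; exists (G x); [exact: GY|rewrite -HFG].
move=> x Yx; apply: (le_trans (h2 x Yx)); rewrite HGF// -mulrA ler_wpM2l//.
by apply: Gg; exact: FY.
Qed.

(** [lam ^+ (2 ^ k) - T ^ (2 ^ k)] is a product of commuting factors, one of
    them [lam - T]. *)
Lemma dyadic_descent k lam C :
  inverse_bounded Y (fun y => lam ^+ (2 ^ k) *: y - iter (2 ^ k) T y) C -> exists C', RB lam C'.
Proof.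
elim: k C => [|k IH] C h; first by exists C; move: h; rewrite expn0 expr1.
suff [C' hC'] : exists C',
    inverse_bounded Y (fun y => lam ^+ (2 ^ k) *: y - iter (2 ^ k) T y) C' by exact: IH hC'.
set a := lam ^+ (2 ^ k); set U := iter (2 ^ k) T.
have UY x : Y x -> Y (U x) by exact: iter_sub_closed.
have aS : lam ^+ (2 ^ k.+1) = a * a by rewrite /a -exprD addnn -mul2n -expnS.
have US x : iter (2 ^ k.+1) T x = U (U x) by rewrite /U -iterD addnn -mul2n -expnS.
apply: (@inverse_bounded_factor _ (fun y => a *: y + U y) _ C (cabs a + c ^+ (2 ^ k)) _ _ _ _ _ h).
- by move=> x Yx; apply: Ylin => //; exact: UY.
- move=> x Yx; apply: (le_trans (rnormD _ _)); rewrite rnormZ mulrDl lerD2l.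
  exact: iter_rnorm.
- by move=> x Yx; apply: sub_subr => //; [exact: sub_scale|exact: UY].
- by move=> x Yx; rewrite aS US /U iter_lin -/U; cmodule.
- by move=> x Yx; rewrite aS US /U iter_sub iter_scale -/U; cmodule.
Qed.

(** [P k] inverts [1 - (T / rho) ^ (2 ^ k)] on [Y]; as [k] grows it converges to
    the Riesz projection onto the part of the spectrum inside the circle of
    radius [rho]. *)
Definition dyadic_family rho (P : nat -> V -> V) K C : Prop :=
  [/\ (forall k y, Y y -> Y (P k y)) /\
      (forall k a x y, Y x -> Y y -> P k (a *: x + y) = a *: P k x + P k y),
      forall k y, Y y -> P k y - (rho%:C ^+ (2 ^ k))^-1 *: iter (2 ^ k) T (P k y) = y,
      forall k y, Y y -> P k (y - (rho%:C ^+ (2 ^ k))^-1 *: iter (2 ^ k) T y) = y,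
      forall k y j, Y y -> (j < 2 ^ k)%N ->
        rnorm (iter j T (P k y)) <= K * rho ^+ j * rnorm y
    & forall y, Y y -> exists2 l, Y l &
        forall k, rnorm (P k y - l) <= C * (5 / 7) ^+ k * rnorm y].

Lemma dyadic_family_exists rho M : 0 < rho -> 0 <= M ->
  (forall lam, cabs lam = rho -> RB lam M) ->
  exists P K C, [/\ 0 <= K, 0 <= C & dyadic_family rho P K C].
Proof.
move=> rho0 M0 hM.
have /choice[inv hinv] : forall lam, exists G : V -> V, cabs lam = rho ->
    forall y, Y y -> Y (G y) /\ lam *: G y - T (G y) = y.
  move=> lam; have [hl|nl] := pselect (cabs lam = rho); last by exists id => /nl.
  by have [G hG] := inverse_choice (hM _ hl); exists G.
have hinv' lam y : cabs lam = rho -> Y y -> Y (inv lam y) /\ lam *: inv lam y - T (inv lam y) = y.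
  by move=> hl; exact: hinv.
have hr : cabs rho%:C = rho by rewrite cabs_real// ltW.
have [C C0 hC] := dyres_limit Yclosed Y0 Ylin rho0 M0 hM hinv'.
exists (fun k => dyres inv k rho%:C), (rho * M), C; split => //.
  by rewrite mulr_ge0// ltW.
split.
- split; first by move=> k y Yy; exact: (dyres_closed Y0 Ylin hinv').
  by move=> k a x y Yx Yy; exact: (dyres_lin Y0 Ylin hM hinv').
- by move=> k y Yy; exact: (dyres_inv_r rho0 hinv').
- by move=> k y Yy; exact: (dyres_inv_l Y0 Ylin TY rho0 hM hinv').
- by move=> k y j Yy jk; exact: (dyres_iter rho0 hM hinv').
- by move=> y Yy; have [l Yl hl] := hC _ _ hr Yy; exists l.
Qed.

Section Family.
Variables (rho K C : R) (P : nat -> V -> V).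
Hypotheses (rho0 : 0 < rho) (K0 : 0 <= K) (C0 : 0 <= C) (hP : dyadic_family rho P K C).

Let W k y := (rho%:C ^+ (2 ^ k))^-1 *: iter (2 ^ k) T y.
Let PY k y : Y y -> Y (P k y). Proof. by move: k y; have [[]] := hP. Qed.
Let Plin k a x y : Y x -> Y y -> P k (a *: x + y) = a *: P k x + P k y.
Proof. by move: k a x y; have [[]] := hP. Qed.
Let Pr k y : Y y -> P k y - W k (P k y) = y. Proof. by move: k y; have [] := hP. Qed.
Let Pl k y : Y y -> P k (y - W k y) = y. Proof. by move: k y; have [] := hP. Qed.
Let Piter k y j : Y y -> (j < 2 ^ k)%N -> rnorm (iter j T (P k y)) <= K * rho ^+ j * rnorm y.
Proof. by move: k y j; have [] := hP. Qed.
Let PK k y : Y y -> rnorm (P k y) <= K * rnorm y.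
Proof. by move=> Yy; have := @Piter k y 0 Yy; rewrite expr0 mulr1; apply; rewrite expn_gt0. Qed.

Let P0 k : P k 0 = 0.
Proof.
by apply/eqP; rewrite -rnorm_eq0 eq_le rnorm_ge0 andbT; have := PK k Y0; rewrite rnorm0 mulr0.
Qed.
Let Padd k x y : Y x -> Y y -> P k (x + y) = P k x + P k y.
Proof. by move=> Yx Yy; rewrite -[x]scale1r Plin// !scale1r. Qed.
Let Pscale k a x : Y x -> P k (a *: x) = a *: P k x.
Proof. by move=> Yx; rewrite -[a *: x]addr0 Plin// P0 addr0. Qed.
Let Psub k x y : Y x -> Y y -> P k (x - y) = P k x - P k y.
Proof. by move=> Yx Yy; rewrite addrC -scaleN1r Plin// scaleN1r addrC. Qed.
Let WY k x : Y x -> Y (W k x).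
Proof. by move=> Yx; apply: (sub_scale Y0 Ylin); exact: iter_sub_closed. Qed.
Let Wlin k a x y : W k (a *: x + y) = a *: W k x + W k y.
Proof. by rewrite /W iter_lin; cmodule. Qed.
Let Wscale k a x : W k (a *: x) = a *: W k x.
Proof. by rewrite /W iter_scale; cmodule. Qed.
Let Wsub k x y : W k (x - y) = W k x - W k y.
Proof. by rewrite /W iter_sub; cmodule. Qed.

Let rhoC k : rho%:C ^+ (2 ^ k) != 0.
Proof. by rewrite expf_neq0// (inj_eq (@complexI R)) gt_eqF. Qed.

Let scaled k lam C' mu : mu = lam ^+ (2 ^ k) / rho%:C ^+ (2 ^ k) ->
  inverse_bounded Y (fun y => mu *: y - W k y) C' ->
  exists C'', RB lam C''.
Proof.
move=> muE [h1 h2]; apply: (@dyadic_descent k lam (C' * cabs (rho%:C ^+ (2 ^ k))^-1)).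
have e x : lam ^+ (2 ^ k) *: x - iter (2 ^ k) T x = rho%:C ^+ (2 ^ k) *: (mu *: x - W k x).
  rewrite scalerBr muE /W !scalerA mulfV// scale1r; congr (_ *: _ - _).
  by rewrite mulrC divfK.
split.
  move=> y Yy; have [x Yx ex] := h1 _ (sub_scale Y0 Ylin (rho%:C ^+ (2 ^ k))^-1 Yy).
  by exists x => //; rewrite e ex scalerA mulfV// scale1r.
move=> x Yx; rewrite e rnormZ -mulrA (mulrA (cabs _)) -cabsM mulVf// cabs1 mul1r.
exact: h2.
Qed.

Let half_ge0 : 0 <= 1 / 2 :> R. Proof. by []. Qed.
Let q1 : 1 / 2 < 1 :> R. Proof. by lra. Qed.

Let subY := sub_subr Y0 Ylin.
Let addY := sub_addr Ylin.
Let scaleY := sub_scale Y0 Ylin.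

(** With [W = (T / rho) ^ (2 ^ k)] and [mu = (lam / rho) ^+ (2 ^ k)], composing
    [P k] with [mu - W = (1 - W) - (1 - mu)] gives [1 - (1 - mu) P k], which is
    close to the identity if [P k] is small. *)
Lemma spectrum_outside k lam : (forall y, Y y -> rnorm (P k y) <= 1 / 4 * rnorm y) ->
  cabs lam <= rho -> exists C', RB lam C'.
Proof.
move=> hq hl; pose mu := lam ^+ (2 ^ k) / rho%:C ^+ (2 ^ k).
apply: (@scaled k lam (2 * K) mu) => //.
have m2 : cabs (1 - mu) <= 2.
  apply: (le_trans (cabsD _ _)); rewrite cabsN cabs1 /mu cabsM cabsV !cabsX cabs_real ?(ltW rho0)//.
  have : cabs lam ^+ (2 ^ k) / rho ^+ (2 ^ k) <= 1.
    by rewrite ler_pdivrMr ?exprn_gt0// mul1r lerXn2r// ?nnegrE ?cabs_ge0 ?ltW.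
  by lra.
have half x : Y x -> rnorm ((1 - mu) *: P k x) <= 1 / 2 * rnorm x.
  move=> Yx; rewrite rnormZ; have := hq x Yx; have := rnorm_ge0 (P k x).
  by have := cabs_ge0 (1 - mu); nra.
split.
  move=> y Yy.
  have [||x Yx ex] := @contraction_fixpoint _ _ _ Yclosed Y0
      (fun x => P k y + (1 - mu) *: P k x) (1 / 2) half_ge0 q1.
  - by move=> x Yx; apply: addY; [exact: PY|apply: scaleY; exact: PY].
  - move=> x x' Yx Yx'.
    have -> : P k y + (1 - mu) *: P k x - (P k y + (1 - mu) *: P k x') = (1 - mu) *: P k (x - x').
      by rewrite Psub//; cmodule.
    by apply: half; exact: subY.
  exists x => //.
  have e : x - W k x = (P k y - W k (P k y)) + (1 - mu) *: (P k x - W k (P k x)).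
    rewrite -{1 2}ex.
    have -> : W k (P k y + (1 - mu) *: P k x) = W k (P k y) + (1 - mu) *: W k (P k x).
      by rewrite addrC Wlin addrC.
    by cmodule.
  rewrite !Pr// in e.
  have -> : mu *: x - W k x = (x - W k x) - (1 - mu) *: x by cmodule.
  by rewrite e; cmodule.
move=> x Yx; set w := mu *: x - W k x.
have Yw : Y w by apply: subY; [exact: scaleY|exact: WY].
have e : P k w = x - (1 - mu) *: P k x.
  have -> : w = (x - W k x) - (1 - mu) *: x by rewrite /w; cmodule.
  by rewrite Psub ?Pl ?Pscale//; [apply: subY => //; exact: WY|exact: scaleY].
have e2 : x = P k w + (1 - mu) *: P k x by rewrite e; cmodule.
have := rnormD (P k w) ((1 - mu) *: P k x); rewrite -e2.
by have := half x Yx; have := PK k Yw; lra.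
Qed.

(** The same computation with [d = 1 / mu]: composing [P k] with [1 - d W]
    gives [1 - (1 - d) (1 - P k)]. *)
Lemma spectrum_inside k lam : (forall y, Y y -> rnorm (y - P k y) <= 1 / 4 * rnorm y) ->
  rho <= cabs lam -> exists C', RB lam C'.
Proof.
move=> hq hl; pose mu := lam ^+ (2 ^ k) / rho%:C ^+ (2 ^ k).
apply: (@scaled k lam (2 * K) mu) => //.
have lam0 : lam != 0 by rewrite -cabs_gt0 (lt_le_trans rho0).
pose d := mu^-1.
have mu0 : mu != 0 by rewrite mulf_neq0 ?invr_eq0// expf_neq0.
have md : d * mu = 1 by rewrite mulVf.
have d1 : cabs d <= 1.
  rewrite /d /mu cabsV cabsM cabsV !cabsX cabs_real ?(ltW rho0)// invfM invrK mulrC.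
  have l0 : 0 < cabs lam by rewrite cabs_gt0.
  by rewrite ler_pdivrMr ?exprn_gt0// mul1r lerXn2r// ?nnegrE ?cabs_ge0 ?(ltW rho0).
have m2 : cabs (1 - d) <= 2.
  by apply: (le_trans (cabsD _ _)); rewrite cabsN cabs1; lra.
have half x : Y x -> rnorm ((1 - d) *: (x - P k x)) <= 1 / 2 * rnorm x.
  move=> Yx; rewrite rnormZ; have := hq x Yx; have := rnorm_ge0 (x - P k x).
  by have := cabs_ge0 (1 - d); nra.
split.
  move=> y Yy.
  have [||x Yx ex] := @contraction_fixpoint _ _ _ Yclosed Y0
      (fun x => d *: P k y + (1 - d) *: (x - P k x)) (1 / 2) half_ge0 q1.
  - by move=> x Yx; apply: addY; apply: scaleY; [exact: PY|apply: subY => //; exact: PY].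
  - move=> x x' Yx Yx'.
    have -> : d *: P k y + (1 - d) *: (x - P k x) - (d *: P k y + (1 - d) *: (x' - P k x')) =
        (1 - d) *: ((x - x') - P k (x - x')).
      by rewrite Psub//; cmodule.
    by apply: half; exact: subY.
  exists x => //.
  have e : x - W k x = d *: (P k y - W k (P k y)) +
      (1 - d) *: ((x - W k x) - (P k x - W k (P k x))).
    rewrite -{1 2}ex.
    have -> : W k (d *: P k y + (1 - d) *: (x - P k x)) =
        d *: W k (P k y) + (1 - d) *: (W k x - W k (P k x)).
      by rewrite Wlin Wscale Wsub.
    by cmodule.
  rewrite !Pr// in e.
  have e3 : d *: (mu *: x - W k x) = d *: y.
    have -> : d *: (mu *: x - W k x) = (d * mu) *: x - d *: W k x by cmodule.
    rewrite md.
    have -> : 1 *: x - d *: W k x = (x - W k x) + (1 - d) *: W k x by cmodule.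
    by rewrite e; cmodule.
  have := congr1 (fun u => mu *: u) e3; rewrite !scalerA mulfV// !scale1r; exact.
move=> x Yx; set w := mu *: x - W k x.
have Yw : Y w by apply: subY; [exact: scaleY|exact: WY].
have e : d *: P k w = x - (1 - d) *: (x - P k x).
  have ew : d *: w = (x - W k x) + (1 - d) *: W k x.
    have -> : d *: w = (d * mu) *: x - d *: W k x by rewrite /w; cmodule.
    by rewrite md; cmodule.
  have ePW : P k (W k x) = P k x - x.
    have -> : W k x = x - (x - W k x) by cmodule.
    by rewrite Psub ?Pl//; apply: subY => //; exact: WY.
  have YWx := WY k Yx.
  rewrite -Pscale// ew Padd; [|exact: subY|exact: scaleY].
  by rewrite Pl// (Pscale k (1 - d) YWx) ePW; cmodule.
have e2 : x = d *: P k w + (1 - d) *: (x - P k x) by rewrite e; cmodule.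
have := rnormD (d *: P k w) ((1 - d) *: (x - P k x)); rewrite -e2 rnormZ.
have h1 := half x Yx; have h2 := PK k Yw.
have h3 : cabs d * rnorm (P k w) <= rnorm (P k w) by rewrite ler_piMl ?rnorm_ge0.
by lra.
Qed.

Let limit_close : exists n, C * (5 / 7) ^+ n <= 1 / 8.
Proof.
have [|||n hn] := @geometric_small R C (5 / 7) (1 / 8); [by lra|by lra|by lra|].
by exists n; exact: hn.
Qed.

(** A nonzero limit [l] of the vectors [P k y] exists, as [P k] is not small;
    the bounds for [T ^ j (P k y)] pass to the limit. *)
Lemma decaying_vector lam : cabs lam <= rho -> ~ (exists C', RB lam C') ->
  exists y, [/\ Y y, y <> 0 & exists B, forall j, rnorm (iter j T y) <= B * rho ^+ j].
Proof.
move=> hl nrb; have [n hn] := limit_close.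
have [y Yy hy] : exists2 y, Y y & 1 / 4 * rnorm y < rnorm (P n y).
  apply: contrapT => h; apply: nrb; apply: (@spectrum_outside n) => // y Yy.
  by rewrite leNgt; apply/negP => hlt; apply: h; exists y.
have [_ _ _ _ /(_ y Yy) [l Yl hl']] := hP.
exists l; split => //.
  move=> l0; have := hl' n; rewrite l0 subr0 => h.
  by have := ler_wpM2r (rnorm_ge0 y) hn; have := rnorm_ge0 y; lra.
exists (K * rnorm y) => j; apply/ler_addgt0Pl => e e0.
have [|||m hm] := @geometric_small R (c ^+ j * (C * rnorm y)) (5 / 7) e; [by lra|by lra|by []|].
have jm : (j < 2 ^ (m + j))%N.
  by apply: (leq_ltn_trans (leq_addl m j)); exact: ltn_expl.
have h1 := Piter Yy jm.
have h2 := iter_rnorm c0 Tc j (l - P (m + j) y); rewrite rnormB in h2.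
have h3 := ler_wpM2l (exprn_ge0 j c0) (hl' (m + j)%N).
have h4 := hm (m + j)%N (leq_addr _ _).
rewrite iter_sub in h2.
have := rnormD (iter j T (l - P (m + j) y)) (iter j T (P (m + j) y)).
rewrite iter_sub subrK rnormB => h5.
rewrite rnormB in h5.
have h6 : c ^+ j * (C * (5 / 7) ^+ (m + j) * rnorm y) = c ^+ j * (C * rnorm y) * (5 / 7) ^+ (m + j).
  by ring.
rewrite h6 in h3.
have h7 : K * rho ^+ j * rnorm y = K * rnorm y * rho ^+ j by ring.
by lra.
Qed.

(** [y - P k y] is not small for some [y], and it is
    [- (T / rho) ^ (2 ^ k) (P k y)], from which a factor [T ^ j] can be split
    off. *)
Lemma divisible_vector lam : rho <= cabs lam -> ~ (exists C', RB lam C') ->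
  exists y, [/\ Y y, y <> 0 & exists B, forall j e, (0 < j)%N -> 0 < e -> exists z,
    [/\ Y z, rnorm z <= B * rho ^- j & rnorm (iter j T z - y) <= e]].
Proof.
move=> hl nrb; have [n hn] := limit_close.
have [y Yy hy] : exists2 y, Y y & 1 / 4 * rnorm y < rnorm (y - P n y).
  apply: contrapT => h; apply: nrb; apply: (@spectrum_inside n) => // y Yy.
  by rewrite leNgt; apply/negP => hlt; apply: h; exists y.
have [_ _ _ _ /(_ y Yy) [l Yl hl']] := hP.
exists (y - l); split.
- exact: subY.
- move=> /eqP; rewrite subr_eq0 => /eqP l0; have := hl' n; rewrite -l0 rnormB => h.
  by have := ler_wpM2r (rnorm_ge0 y) hn; have := rnorm_ge0 y; lra.
exists (K * rnorm y) => j e j0 e0.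
have [|||m hm] := @geometric_small R (C * rnorm y) (5 / 7) e; [by lra|by lra|by []|].
have jm : (j < 2 ^ (m + j))%N.
  by apply: (leq_ltn_trans (leq_addl m j)); exact: ltn_expl.
set k := (m + j)%N in jm *.
have Yz i : Y (iter i T (P k y)) by apply: (iter_sub_closed TY); exact: PY.
have jk : (2 ^ k - j < 2 ^ k)%N by rewrite ltn_subrL j0 expn_gt0.
exists (- (rho%:C ^+ (2 ^ k))^-1 *: iter (2 ^ k - j) T (P k y)); split.
- exact: scaleY.
- rewrite rnormZ cabsN cabsV cabsX cabs_real ?(ltW rho0)//.
  have h1 := Piter Yy jk.
  have rk : 0 < rho ^+ (2 ^ k) by exact: exprn_gt0.
  have rj : 0 < rho ^+ j by exact: exprn_gt0.
  rewrite mulrC ler_pdivrMr//; apply: (le_trans h1).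
  have -> : rho ^+ (2 ^ k) = rho ^+ (2 ^ k - j) * rho ^+ j by rewrite -exprD subnK// ltnW.
  rewrite le_eqVlt; apply/orP; left; apply/eqP; field; by rewrite expf_neq0// gt_eqF.
- have -> : iter j T (- (rho%:C ^+ (2 ^ k))^-1 *: iter (2 ^ k - j) T (P k y)) = y - P k y.
    rewrite iter_scale -iterD subnKC ?(ltnW jm)//.
    have -> : y - P k y = - W k (P k y) by rewrite -{1}(Pr k Yy); cmodule.
    by rewrite /W; cmodule.
  have -> : y - P k y - (y - l) = - (P k y - l) by cmodule.
  rewrite rnormN; apply: (le_trans (hl' k)).
  have := hm k (leq_addr _ _); congr (_ <= _); ring.
Qed.

End Family.

(** If [P] inverts [1 - X], then [X y = P (X y) - P (X^2 y)] and
    [P (X y) = P y - y]; here [X = T ^ (2 ^ k)]. *)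
Lemma hyperbolic_estimate P K C : 0 <= K -> dyadic_family 1 P K C ->
  exists2 B, 0 <= B & forall k y, Y y ->
    rnorm (iter (2 ^ k) T y) <= B * (rnorm y + rnorm (iter (2 ^ k.+1) T y)).
Proof.
move=> K0 [[PY Plin] Pr Pl PK _]; exists (K + 1); first by rewrite addr_ge0.
move=> k y Yy; set x := iter (2 ^ k) T y.
have Yx : Y x by exact: iter_sub_closed.
have Yxx : Y (iter (2 ^ k) T x) by exact: iter_sub_closed.
have xx : iter (2 ^ k.+1) T y = iter (2 ^ k) T x by rewrite /x -iterD addnn -mul2n -expnS.
have bd z : Y z -> rnorm (P k z) <= K * rnorm z.
  by move=> Yz; have := PK k z 0 Yz; rewrite expr0 mulr1; apply; rewrite expn_gt0.
have e1 := Pl k y Yy; rewrite rmorph1 expr1n invr1 scale1r -/x in e1.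
have e2 := Pl k x Yx; rewrite rmorph1 expr1n invr1 scale1r in e2.
have Psub u v : Y u -> Y v -> P k (u - v) = P k u - P k v.
  by move=> Yu Yv; rewrite addrC -scaleN1r Plin// scaleN1r addrC.
rewrite Psub// in e1; rewrite Psub// in e2.
have e3 : x = P k y - y - P k (iter (2 ^ k) T x).
  by rewrite -[LHS]e2 -[in X in _ - X - _]e1; cmodule.
have := bd y Yy; have := bd _ Yxx.
have := rnormD (P k y - y) (- P k (iter (2 ^ k) T x)); rewrite -e3 rnormN.
have := rnormD (P k y) (- y); rewrite rnormN xx.
have := rnorm_ge0 y; have := rnorm_ge0 (iter (2 ^ k) T x); lra.
Qed.

(** Uses the dyadic families of three circles: one slightly smaller than the
    unit circle for [y1], one slightly larger for [y2], so that both decay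
    exponentially, and the unit circle itself for the last estimate. *)
Lemma dichotomy lam1 lam2 : (forall lam, cabs lam = 1 -> exists C, RB lam C) ->
  cabs lam1 < 1 -> ~ (exists C, RB lam1 C) ->
  1 < cabs lam2 -> ~ (exists C, RB lam2 C) ->
  exists q B y1 y2, [/\ 0 <= q < 1, 0 <= B,
    [/\ Y y1, y1 <> 0 & forall j, rnorm (iter j T y1) <= B * q ^+ j],
    [/\ Y y2, y2 <> 0 & forall j e, (0 < j)%N -> 0 < e -> exists z,
      [/\ Y z, rnorm z <= B * q ^+ j & rnorm (iter j T z - y2) <= e]]
    & forall k y, Y y ->
      rnorm (iter (2 ^ k) T y) <= B * (rnorm y + rnorm (iter (2 ^ k.+1) T y))].
Proof.
move=> hc l1 n1 l2 n2.
have [M M1 hM] := circle_uniform Yclosed Y0 Ylin hc.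
have M0 : 0 < M by apply: lt_le_trans M1.
have ann := annulus_uniform Yclosed Y0 Ylin M1 hM.
pose d := (4 * M)^-1.
have d0 : 0 < d by rewrite invr_gt0 mulr_gt0.
have d1 : d < 1 by rewrite invf_lt1 ?mulr_gt0//; lra.
have r0 : 0 < 1 - d by lra.
have s0 : 0 < 1 + d by lra.
have M20 : 0 <= 2 * M by rewrite mulr_ge0// ltW.
have far lam : ~ (exists C, RB lam C) -> d < `|cabs lam - 1|.
  by move=> nl; rewrite ltNge; apply/negP => h; apply: nl; exists (2 * M); exact: ann.
have circ rho : `|rho - 1| <= d -> forall lam, cabs lam = rho -> RB lam (2 * M).
  by move=> hr lam hl; apply: ann; rewrite hl.
have [|P1 [K1 [C1 [K10 C10 fam1]]]] := @dyadic_family_exists (1 - d) (2 * M) r0 M20.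
  by apply: circ; rewrite addrAC subrr add0r normrN gtr0_norm.
have [|P2 [K2 [C2 [K20 C20 fam2]]]] := @dyadic_family_exists (1 + d) (2 * M) s0 M20.
  by apply: circ; rewrite addrAC subrr add0r gtr0_norm.
have [|P3 [K3 [C3 [K30 C30 fam3]]]] := @dyadic_family_exists 1 (2 * M) ltr01 M20.
  by apply: circ; rewrite subrr normr0 ltW.
have f1 : cabs lam1 <= 1 - d by have := far _ n1; rewrite ltr0_norm; lra.
have f2 : 1 + d <= cabs lam2 by have := far _ n2; rewrite gtr0_norm; lra.
have [y1 [Yy1 y10 [B1 hB1]]] := decaying_vector r0 fam1 f1 n1.
have [y2 [Yy2 y20 [B2 hB2]]] := divisible_vector s0 fam2 f2 n2.
have [B3 B30 hB3] := hyperbolic_estimate K30 fam3.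
pose q := Num.max (1 - d) (1 + d)^-1.
pose B := Num.max B3 (Num.max B1 B2).
have q0 : 0 <= q by rewrite le_max (ltW r0).
have BB : [/\ B1 <= B, B2 <= B & B3 <= B] by rewrite /B !le_max !lexx !orbT.
have [BB1 BB2 BB3] := BB.
have B0 : 0 <= B by exact: le_trans BB3.
exists q, B, y1, y2; split => //.
- by rewrite q0 gt_max invf_lt1//; apply/andP; split; lra.
- split => // j; apply: (le_trans (hB1 j)).
  apply: ler_pM => //.
  + by have := le_trans (rnorm_ge0 _) (hB1 0); rewrite expr0 mulr1.
  + by rewrite exprn_ge0// ltW.
  + by rewrite lerXn2r// ?nnegrE ?(ltW r0)// /q le_max lexx.
- split => // j e j0 e0; have [z [Yz hz1 hz2]] := hB2 j e j0 e0.
  exists z; split => //; apply: (le_trans hz1); rewrite -exprVn.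
  have i0 : 0 <= (1 + d)^-1 by rewrite invr_ge0 ltW.
  have B20 : 0 <= B2.
    have := le_trans (rnorm_ge0 _) hz1; rewrite pmulr_lge0// invr_gt0; exact: exprn_gt0.
  apply: ler_pM => //; first exact: exprn_ge0.
  by rewrite lerXn2r// ?nnegrE// /q le_max lexx orbT.
- move=> k y Yy; apply: (le_trans (hB3 k y Yy)).
  by rewrite ler_wpM2r// addr_ge0// rnorm_ge0.
Qed.

End ExponentialDichotomy.

(** * Analytic AIM-subspaces *)

Section SpectrumModulus.
Variables (R : realType) (E : realBanachLatticeType R) (X : complexBanachLatticeType E).
Implicit Types (x y z : X) (u v w : E) (e : R) (n : nat) (lam : R[i]) (Y : set X).

Lemma closed_subspaceP Y : closed_subspace Y ->
  [/\ closed Y, Y 0 & forall a x y, Y x -> Y y -> Y (a *: x + y)].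
Proof.
move=> [[h0 hl] hc]; split => //; first by move: h0; rewrite inE.
by move=> a x y Yx Yy; have := hl a x y; rewrite !inE; apply.
Qed.

(** The double disjoint complement of [y], the smallest band containing [y].
    For its closedness under suprema, take [s = sup D] and let [m] be the meet
    of the positive part of [s] with [|w|]: every element of [D] is disjoint
    from [m], hence below [s - m], so that [m = 0]. *)
Lemma dcompl_band y : is_band [set x : X | forall w : X, disjointv w y -> disjointv x w].
Proof.
split.
- split; first by rewrite inE => w _; rewrite /disjointv vmod0 meetv_l//; exact: vmod_ge0.
  move=> a x1 x2; rewrite !inE /= => h1 h2 w hw.
  have w0 := vmod_ge0 w; have x10 := vmod_ge0 x1; have x20 := vmod_ge0 x2.
  have ax0 : lev 0 (cabs a *: vmod x1) by apply: lev_scale0 => //; exact: cabs_ge0.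
  have d1 := h1 w hw; rewrite /disjointv meetvC in d1.
  have d2 := h2 w hw; rewrite /disjointv meetvC in d2.
  rewrite /disjointv; apply: (@disj_le _ _ (cabs a *: vmod x1 + vmod x2)) => //.
  + by rewrite meetvC; apply: disjD => //; apply: disjZ => //; exact: cabs_ge0.
  + exact: vmod_ge0.
  + by apply: (levT (vmodD _ _)); rewrite vmodZ; exact: lev_refl.
- move=> x1 x2 h2 h12 w hw; rewrite /disjointv.
  by apply: (disj_le (h2 w hw)) => //; exact: vmod_ge0.
- move=> D s hD [sub slub] w hw.
  have w0 := vmod_ge0 w; set b := vmod w in w0 *.
  have dD d : D d -> meetv (absv d) b = 0.
    by move=> Dd; have := hD d Dd w hw; rewrite /disjointv vmod_real.
  have sp : meetv (posv s) b = 0.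
    have m0 : lev 0 (meetv (posv s) b) by apply: meetv_ge0 => //; exact: posv_ge0.
    apply: lev_anti => //.
    suff h : lev s (s - meetv (posv s) b) by apply: (lev_eq1 h); module.
    apply: slub => d Dd; have ds := sub d Dd.
    have pd : lev (posv d) (absv d) by rewrite absvE; apply: lev_addr; exact: posv_ge0.
    have dj : meetv (posv d) (meetv (posv s) b) = 0.
      apply: (disj_le2 (dD d Dd)) => //; [exact: posv_ge0|exact: levIr].
    have h1 := disj_add_le dj (posvS ds) (levIl (posv s) b).
    have h2 := posvS (lev_opp ds).
    rewrite -[X in lev X _]posv_sub -[X in lev _ (X - _)](posv_sub s).
    by apply: (lev_eq2 h1 h2); module.
  have sn : meetv (posv (- s)) b = 0.
    (* The supremum of the empty set, if it exists, is the least element, and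
    then the lattice is trivial. *)
    have [[d Dd]|nD] := pselect (exists d, D d).
      apply: (disj_le (dD d Dd)) => //; first exact: posv_ge0.
      apply: (levT (posvS (lev_opp (sub d Dd)))).
      by rewrite absvE addrC; apply: lev_addr; exact: posv_ge0.
    have h : lev s (s + s) by apply: slub => d Dd; case: nD; exists d.
    have s0 : lev 0 s by apply: (lev_eq1 h); module.
    have s1 : lev (- s) 0 by apply: (lev_eq1 s0); module.
    by rewrite (posv0 s1) meetv_l.
  rewrite /disjointv vmod_real absvE meetvC.
  by apply: disjD; rewrite 1?meetvC//; exact: posv_ge0.
Qed.

Lemma analytic_nondisjoint Y y1 y2 : analytic_subspace Y -> Y y1 ->
  y2 <> 0 -> disjointv y1 y2 -> y1 = 0.
Proof.
move=> [_ hY] Yy1 y20 d12; apply: (hY _ (dcompl_band y2)) => //.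
  move=> B0; apply: y20.
  have : [set x : X | forall w : X, disjointv w y2 -> disjointv x w] y2.
    by move=> w; rewrite /disjointv meetvC.
  by rewrite B0.
by move=> e /(_ y1 d12); rewrite /disjointv meetvC.
Qed.

Lemma inverse_bounded_invertible Y (F : X -> X) C :
  (forall x y, Y x -> Y y -> Y (x - y)) ->
  (forall x y, F (x - y) = F x - F y) -> (forall x, Y x -> Y (F x)) ->
  inverse_bounded Y F C -> invertible_on Y F.
Proof.
move=> Ysub Fsub FY hF; have [G hG] := inverse_choice hF; have [_ h2] := hF.
exists G; split.
- by move=> y Yy; exact: (hG y Yy).1.
- exists C => y Yy; have [Yg eg] := hG y Yy.
  by rewrite !rnormE -rmorphM lecR; have := h2 _ Yg; rewrite eg.
- move=> x; rewrite inE => Yx; have [Yg eg] := hG _ (FY x Yx).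
  apply/eqP; rewrite -subr_eq0; apply/eqP; apply: rnorm_small => e e0.
  apply: (le_trans (h2 _ (Ysub _ _ Yg Yx))).
  by rewrite Fsub eg subrr rnorm0 mulr0 ltW.
- by move=> y; rewrite inE => Yy; exact: (hG y Yy).2.
Qed.

Lemma invertible_inverse_bounded Y (F : X -> X) : (forall x, Y x -> Y (F x)) ->
  invertible_on Y F -> exists C, inverse_bounded Y F C.
Proof.
move=> FY [G [GY [C hC] FG GF]]; exists C; split.
  by move=> y Yy; exists (G y); [exact: GY|apply: GF; rewrite inE].
move=> x Yx; have := hC _ (FY x Yx).
by rewrite FG ?inE// !rnormE -rmorphM lecR.
Qed.

Section Gap.
Variables (Y : set X) (S A T : {linear X -> X}).
Hypotheses (hYaim : AIM_subspace Y) (hS : d_isomorphism S) (hA : in_center A).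
Hypotheses (hT : forall x, T x = A (S x)).

Local Notation tau := (absop T).

Section Estimate.
Variables (N : nat) (B : R).
Hypothesis B0 : 0 <= B.
Hypothesis hB : forall y, Y y ->
  rnorm (iter N T y) <= B * (rnorm y + rnorm (iter (N + N) T y)).

Let tau_iter_ge0 n u : lev 0 u -> lev 0 (iter n tau u).
Proof. by case: n => //= n _; exact: vmod_ge0. Qed.

(** Both sides of the estimate on [Y] depend on [|y|] only, continuously. *)
Lemma positive_estimate w : lev 0 w ->
  `|iter N tau w| <= B * (`|w| + `|iter (N + N) tau w|).
Proof.
move=> w0; have [c c0 lip] := iter_absop_lip hS hA hT.
have itE := iter_absop hS hA hT.
apply/ler_addgt0Pl => e e0.
pose D := c ^+ N + B * (1 + c ^+ (N + N)).
have D0 : 0 <= D.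
  by rewrite addr_ge0 ?exprn_ge0// mulr_ge0// addr_ge0// exprn_ge0.
have d0 : 0 < e / (D + 1) by rewrite divr_gt0// ltr_wpDl.
have [_ aim] := hYaim.
have [y Yy] := aim (vreal w) _ d0; rewrite vmod_pos// => hy.
have := hB Yy; rewrite !rnorm_vmod !itE => h.
have l1 := le_trans (lip N w (vmod y)) (ler_wpM2l (exprn_ge0 N c0) hy).
rewrite distrC in hy.
have l2 := le_trans (lip (N + N)%N (vmod y) w) (ler_wpM2l (exprn_ge0 (N + N) c0) hy).
set d := e / (D + 1) in d0 hy l1 l2.
have t1 := ler_normD (iter N tau w - iter N tau (vmod y)) (iter N tau (vmod y)).
have t2 := ler_normD (iter (N + N) tau (vmod y) - iter (N + N) tau w) (iter (N + N) tau w).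
have t3 := ler_normD (vmod y - w) w.
rewrite !subrK in t1 t2 t3.
have De : c ^+ N * d + B * (d + c ^+ (N + N) * d) <= e.
  have -> : c ^+ N * d + B * (d + c ^+ (N + N) * d) = D * d by rewrite /D; ring.
  by rewrite /d mulrCA ler_piMr ?(ltW e0)// ler_pdivrMr ?ltr_wpDl// mul1r lerDl.
have s1 : `|vmod y| + `|iter (N + N) tau (vmod y)| <=
    (`|w| + `|iter (N + N) tau w|) + (d + c ^+ (N + N) * d) by lra.
have := ler_wpM2l B0 s1; rewrite mulrDr => s2; lra.
Qed.

(** Apply the previous estimate to [w <= v] with [tau^N w] close to [u]. *)
Lemma interval_estimate u v : lev 0 u -> lev 0 v -> lev u (iter N tau v) ->
  `|u| <= B * (`|v| + `|iter N tau u|).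
Proof.
move=> u0 v0 uv; have [c c0 lip] := iter_absop_lip hS hA hT.
apply/ler_addgt0Pl => e e0.
have d0 : 0 < e / (1 + B * c ^+ N).
  by rewrite divr_gt0// ltr_wpDr// mulr_ge0// exprn_ge0.
have [w [w0 wv we]] := iter_absop_interval hS hA hT u0 v0 uv d0.
set d := e / _ in d0 we.
have De : d * (1 + B * c ^+ N) = e.
  by rewrite /d divfK// gt_eqF// ltr_wpDr// mulr_ge0// exprn_ge0.
have h1 := positive_estimate w0; rewrite iterD in h1.
have h2 := le_trans (lip N (iter N tau w) u) (ler_wpM2l (exprn_ge0 N c0) we).
have h3 := lev_norm_ge0 w0 wv.
have t1 := ler_normD (iter N tau (iter N tau w) - iter N tau u) (iter N tau u).
have t2 := ler_normD (u - iter N tau w) (iter N tau w).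
rewrite subrK in t1; rewrite subrK distrC in t2.
have s1 : `|w| + `|iter N tau (iter N tau w)| <= `|v| + `|iter N tau u| + c ^+ N * d by lra.
have := ler_wpM2l B0 s1; rewrite mulrDr => s2.
have e2 : d + B * (c ^+ N * d) = e by rewrite -De; ring.
lra.
Qed.

Lemma meet_estimate a b (y1 y2 : X) : rnorm (iter N T y1) <= a ->
  (forall e, 0 < e -> exists z, rnorm z <= b /\ rnorm (iter N T z - y2) <= e) ->
  `|meetv (vmod y1) (vmod y2)| <= B * (b + a).
Proof.
move=> ha hb; apply/ler_addgt0Pl => e e0; have [z [zb ze]] := hb e e0.
have itE := iter_absop hS hA hT.
have y10 := vmod_ge0 y1.
pose u := meetv (vmod y1) (vmod (iter N T z)).
have u0 : lev 0 u by apply: meetv_ge0; exact: vmod_ge0.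
have uz : lev u (iter N tau (vmod z)) by rewrite -itE; exact: levIr.
have h1 := interval_estimate u0 (vmod_ge0 z) uz.
have h2 : `|iter N tau u| <= a.
  apply: le_trans ha; rewrite rnorm_vmod itE; apply: lev_norm_ge0; first exact: tau_iter_ge0.
  by apply: (iter_absop_mono hS hA hT) => //; exact: levIl.
have h3 : `|meetv (vmod y1) (vmod y2) - u| <= e.
  apply: le_trans ze; rewrite rnormB.
  apply: le_trans (rnorm_dist _ _); rewrite -[leRHS]norm_absv.
  by apply: lev_absv_norm; exact: meetv_lip_abs.
have t := ler_normD (meetv (vmod y1) (vmod y2) - u) u; rewrite subrK in t.
rewrite rnorm_vmod in zb.
have := ler_wpM2l B0 (lerD zb h2); lra.
Qed.

End Estimate.

Hypothesis hYan : analytic_subspace Y.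
Hypothesis hTY : forall y, Y y -> Y (T y).

(** For the two vectors of the dichotomy, [meet_estimate] with [N = 2 ^ k] shows
    that they are disjoint. *)
Lemma unit_gap lam1 lam2 :
  (forall lam, cabs lam = 1 -> exists C, inverse_bounded Y (fun y => lam *: y - T y) C) ->
  cabs lam1 < 1 -> ~ (exists C, inverse_bounded Y (fun y => lam1 *: y - T y) C) ->
  1 < cabs lam2 -> ~ (exists C, inverse_bounded Y (fun y => lam2 *: y - T y) C) ->
  False.
Proof.
move=> hc l1 n1 l2 n2.
have [cY Y0 Ylin] := closed_subspaceP hYan.1.
have [c c0 Tc] := weighted_rnorm hS hA hT.
have [q [B [y1 [y2 [/andP[q0 q1] B0 [Yy1 y10 h1] [Yy2 y20 h2] h3]]]]] :=
  dichotomy cY Y0 Ylin hTY c0 Tc hc l1 n1 l2 n2.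
apply: y10; apply: (analytic_nondisjoint hYan Yy1 y20).
apply/eqP; rewrite -normr_le0; apply/ler_addgt0Pl => e e0; rewrite addr0.
have [k hk] := geometric_small (2 * B * B) q0 q1 e0.
have h3' y : Y y -> rnorm (iter (2 ^ k) T y) <=
    B * (rnorm y + rnorm (iter (2 ^ k + 2 ^ k) T y)).
  by move=> Yy; have := h3 k y Yy; rewrite expnS mul2n -addnn.
have kN : (k <= 2 ^ k)%N by apply: ltnW; exact: ltn_expl.
have N0 : (0 < 2 ^ k)%N by rewrite expn_gt0.
apply: (le_trans (meet_estimate B0 h3' (h1 (2 ^ k)%N) (b := B * q ^+ (2 ^ k)) _)).
  by move=> d d0; have [z [_ z1 z2]] := h2 _ d N0 d0; exists z.
by have := hk _ kN; congr (_ <= _); ring.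
Qed.

End Gap.

End SpectrumModulus.

Theorem theorem0p9 (R : realType) (E : realBanachLatticeType R)
    (X : complexBanachLatticeType E)
    (Y : set X) (S A T : {linear X -> X})
    (hYan : analytic_subspace Y) (hYaim : AIM_subspace Y)
    (hS : d_isomorphism S) (hA : in_center A)
    (hT : forall x : X, T x = A (S x))
    (hTY : forall y : X, Y y -> Y (T y)) :
  connected [set complex.Re `|lam| | lam in spectrum_on T Y].
Proof.
have [cY Y0 Ylin] := closed_subspaceP hYan.1.
have subY := sub_subr Y0 Ylin; have scaleY := sub_scale Y0 Ylin.
apply/connected_intervalP => a b [lam1 sp1 <-] [lam2 sp2 <-] t.
rewrite -/(cabs lam1) -/(cabs lam2) => /andP[t1 t2].
apply: contrapT => nt.
have tnot lam : cabs lam = t -> invertible_on Y (fun y => lam *: y - T y).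
  by move=> ht; apply: contrapT => h; apply: nt; exists lam.
have t1' : cabs lam1 < t.
  by rewrite lt_neqAle t1 andbT; apply/eqP => e; apply: sp1; exact: tnot.
have t2' : t < cabs lam2.
  by rewrite lt_neqAle t2 andbT; apply/eqP => e; apply: sp2; exact: tnot.
have t0 : 0 < t by apply: le_lt_trans t1'; exact: cabs_ge0.
have tC : t%:C != 0 by rewrite (inj_eq (@complexI R)) gt_eqF.
pose T' : {linear X -> X} := (t%:C^-1 \*: T).
pose A' : {linear X -> X} := (t%:C^-1 \*: A).
have ct : cabs t%:C^-1 = t^-1 by rewrite cabsV cabs_real// ltW.
have hA' : in_center A'.
  have [c cge hc] := hA; exists (t^-1 * c) => [|x]; first by rewrite mulr_ge0// invr_ge0 ltW.
  by rewrite /= vmodZ ct -scalerA; apply: lev_scale => //; rewrite invr_ge0 ltW.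
have hT' x : T' x = A' (S x) by rewrite /= hT.
have hTY' y : Y y -> Y (T' y) by move=> Yy; apply: scaleY; exact: hTY.
have FY lam x : Y x -> Y (lam *: x - T x).
  by move=> Yx; apply: subY; [exact: scaleY|exact: hTY].
have resc lam x : lam *: x - T' x = t%:C^-1 *: ((t%:C * lam) *: x - T x).
  by rewrite /= scalerBr !scalerA mulKf.
have up lam C : inverse_bounded Y (fun y => (t%:C * lam) *: y - T y) C ->
    exists C', inverse_bounded Y (fun y => lam *: y - T' y) C'.
  move=> [h1 h2]; exists (C * t); split.
    move=> y Yy; have [x Yx ex] := h1 _ (scaleY t%:C _ Yy).
    by exists x => //; rewrite resc ex scalerA mulVf// scale1r.
  move=> x Yx; rewrite resc rnormZ ct -mulrA mulVKf ?gt_eqF//; exact: h2.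
have down lam C : inverse_bounded Y (fun y => lam *: y - T' y) C ->
    exists C', inverse_bounded Y (fun y => (t%:C * lam) *: y - T y) C'.
  move=> [h1 h2]; exists (C * t^-1); split.
    move=> y Yy; have [x Yx ex] := h1 _ (scaleY t%:C^-1 _ Yy).
    exists x => //; have := congr1 (fun u => t%:C *: u) ex.
    by rewrite /= resc !scalerA mulfV// !scale1r.
  by move=> x Yx; have := h2 _ Yx; rewrite resc rnormZ ct mulrA.
have spec lam : ~ invertible_on Y (fun y => lam *: y - T y) ->
    ~ (exists C, inverse_bounded Y (fun y => (lam / t%:C) *: y - T' y) C).
  move=> nl [C hC]; apply: nl; have [C' hC'] := down _ _ hC.
  rewrite mulrC divfK// in hC'.
  apply: inverse_bounded_invertible hC' => //; last by move=> x; exact: FY.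
  by move=> x y; rewrite (linearB T); cmodule.
apply: (@unit_gap R E X Y S A' T' hYaim hS hA' hT' hYan hTY' (lam1 / t%:C) (lam2 / t%:C)).
- move=> lam hl; have tl : cabs (t%:C * lam) = t by rewrite cabsM hl mulr1 cabs_real// ltW.
  have [C hC] := invertible_inverse_bounded (FY (t%:C * lam)) (tnot _ tl).
  exact: up hC.
- by rewrite cabsM ct ltr_pdivrMr// mul1r.
- exact: spec.
- by rewrite cabsM ct ltr_pdivlMr// mul1r.
- exact: spec.
Qed.
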